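(* For real $J_1,J_2,J_3$ let $\chi(T)$ denote the zero field susceptibility at temperature $T>0$ of the spin triangle with Hamiltonian $H=J_1\,\mathbf{s}_2\cdot\mathbf{s}_3+J_2\,\mathbf{s}_3\cdot\mathbf{s}_1+J_3\,\mathbf{s}_1\cdot\mathbf{s}_2$ on $\mathcal{P}=\mathcal{S}^2\times\mathcal{S}^2\times\mathcal{S}^2$. Then: (i) for all real $J_1,J_2,J_3$, $\lim_{T\to\infty}T\,\chi(T)=1$; (ii) for $J_1=-\frac12$, $J_2=\frac12+\frac{\sqrt2}{2}$, $J_3=\frac{\sqrt2}{2}$, $\lim_{T\to0^+}T\,\chi(T)=\frac13$; (iii) for the sign-inverted coupling constants $J_1=\frac12$, $J_2=-\frac12-\frac{\sqrt2}{2}$, $J_3=-\frac{\sqrt2}{2}$, $\lim_{T\to0^+}T\,\chi(T)=\frac{11}{6}+\frac{1}{\sqrt2}$.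
   Context: $\mathcal{S}^2\subset\mathbb{R}^3$ is the unit sphere, $\mathbf{s}_1,\mathbf{s}_2,\mathbf{s}_3\in\mathcal{S}^2$ are the components of a point of $\mathcal{P}$, and $dV$ is the product of the surface measures on $\mathcal{P}$. Let $\mathbf{S}=\mathbf{s}_1+\mathbf{s}_2+\mathbf{s}_3$ with third component $\mathbf{S}^{(3)}$. For $B\in\mathbb{R}$ let $H_B=H-B\,\mathbf{S}^{(3)}$, and, with $\beta=1/T$, let the magnetization be $M(B)=\frac{\int_{\mathcal{P}}\mathbf{S}^{(3)}e^{-\beta H_B}\,dV}{\int_{\mathcal{P}}e^{-\beta H_B}\,dV}$. The zero field susceptibility is $\chi(T)=\frac{dM}{dB}\big|_{B=0}$. *)

(* Defs.v *)
From HB Require Import structures.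
From mathcomp Require Import all_boot all_order all_algebra.
From mathcomp Require Import all_classical all_reals all_analysis.
From mathcomp Require Import measurable_realfun.
Import Order.TTheory GRing.Theory Num.Theory.
Import numFieldNormedType.Exports.

Set Implicit Arguments.
Unset Strict Implicit.
Unset Printing Implicit Defensive.

Local Open Scope classical_set_scope.
Local Open Scope ring_scope.

(** Plane and space as products of Borel lines. *)
Notation vec2 R := (measurableTypeR R * measurableTypeR R)%type.
Notation vec3 R :=
  (measurableTypeR R * measurableTypeR R * measurableTypeR R)%type.

Definition dot3 {R : realType} (s t : vec3 R) : R :=
  s.1.1 * t.1.1 + s.1.2 * t.1.2 + s.2 * t.2.

Definition sphere2 (R : realType) : set (vec3 R) := [set s | dot3 s s = 1].
Arguments sphere2 R : clear implicits.

(** Spherical coordinates: u = (polar angle, azimuth). *)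
Definition sphere_param {R : realType} (u : vec2 R) : vec3 R :=
  (sin u.1 * cos u.2, sin u.1 * sin u.2, cos u.1).

Definition sphere_chart (R : realType) : set (vec2 R) :=
  `[0, pi]%classic `*` `[0, pi *+ 2]%classic.
Arguments sphere_chart R : clear implicits.

(** Surface area on the unit sphere, as a Borel measure on R^3 carried by the
    sphere: the area of A is the integral, over the parameters (theta, phi)
    mapped into A, of the area element
    |d_theta r x d_phi r| dtheta dphi = sin theta dtheta dphi. *)
Definition surface_measure {R : realType} (A : set (vec3 R)) : \bar R :=
  (\int[lebesgue_measure \x lebesgue_measure]_(u in
     sphere_chart R `&` sphere_param @^-1` A) (sin u.1)%:E)%E.

Section surface_measure.
Context {R : realType}.

Let mu2 : set (vec2 R) -> \bar R := (lebesgue_measure \x lebesgue_measure)%E.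

Lemma measurable_sphere_param : measurable_fun setT (@sphere_param R).
Proof.
have ms : measurable_fun setT (@sin R).
  by apply: continuous_measurable_fun; exact: continuous_sin.
have mc : measurable_fun setT (@cos R).
  by apply: continuous_measurable_fun; exact: continuous_cos.
have m1 (f : R -> R) : measurable_fun setT f ->
    measurable_fun setT (fun u : vec2 R => f u.1).
  by move=> mf; exact: (measurableT_comp mf measurable_fst).
have m2 (f : R -> R) : measurable_fun setT f ->
    measurable_fun setT (fun u : vec2 R => f u.2).
  by move=> mf; exact: (measurableT_comp mf measurable_snd).
apply/measurable_fun_pairP; split; last exact: m1.
apply/measurable_fun_pairP; split.
- by apply: measurable_funM; [exact: m1|exact: m2].
- by apply: measurable_funM; [exact: m1|exact: m2].
Qed.

Lemma measurable_sphere_chart : measurable (sphere_chart R).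
Proof. by apply: measurableX; exact: measurable_itv. Qed.

Lemma measurable_sphere_element :
  measurable_fun setT (fun u : vec2 R => (sin u.1)%:E).
Proof.
apply/measurable_EFinP; apply: (@measurableT_comp _ _ _ _ _ _ (@sin R) _ fst) => //.
by apply: continuous_measurable_fun; exact: continuous_sin.
Qed.

Lemma sphere_element_ge0 (u : vec2 R) : sphere_chart R u -> 0 <= sin u.1.
Proof. by case=> /= + _; rewrite in_itv/= => /sin_ge0_pi. Qed.

Let measurable_pre (A : set (vec3 R)) : measurable A ->
  measurable (sphere_chart R `&` sphere_param @^-1` A).
Proof.
move=> mA; apply: measurableI; first exact: measurable_sphere_chart.
by rewrite -[X in measurable X]setTI; exact: measurable_sphere_param.
Qed.

Let surface_measure0 : surface_measure (set0 : set (vec3 R)) = 0%E.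
Proof. by rewrite /surface_measure preimage_set0 setI0 integral_set0. Qed.

Let surface_measure_ge0 (A : set (vec3 R)) : (0 <= surface_measure A)%E.
Proof.
by apply: integral_ge0 => u [uc _]; rewrite lee_fin sphere_element_ge0.
Qed.

Let surface_measure_sigma_additive : semi_sigma_additive (@surface_measure R).
Proof.
move=> F mF tF mUF; rewrite /surface_measure preimage_bigcup setI_bigcupr.
rewrite ge0_integral_bigcup//=.
- by apply: is_cvg_ereal_nneg_natsum_cond => n _ _; exact: surface_measure_ge0.
- by move=> k; exact: measurable_pre.
- exact: measurable_funTS measurable_sphere_element.
- by move=> u [k _ [uc _]]; rewrite lee_fin sphere_element_ge0.
- move=> i j _ _ [u [[_ Fiu] [_ Fju]]]; apply: tF => //.
  by exists (sphere_param u).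
Qed.

HB.instance Definition _ := isMeasure.Build _ _ _ (@surface_measure R)
  surface_measure0 surface_measure_ge0 surface_measure_sigma_additive.

Let surface_measure_fin : fin_num_fun (@surface_measure R).
Proof.
move=> A mA; rewrite ge0_fin_numE//.
apply: (@le_lt_trans _ _ (mu2 (sphere_chart R))).
  rewrite -[leRHS]mul1e -integral_cst; last exact: measurable_sphere_chart.
  apply: (@le_trans _ _ (\int[mu2]_(u in sphere_chart R `&` sphere_param @^-1` A) 1)%E).
    apply: ge0_le_integral => //.
    - exact: measurable_pre.
    - by move=> u [uc _]; rewrite lee_fin sphere_element_ge0.
    - exact: measurable_funTS measurable_sphere_element.
    - by move=> u _; rewrite lee_fin sin_le1.
  apply: ge0_subset_integral => //; first exact: measurable_pre.
  exact: measurable_sphere_chart.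
rewrite /mu2 /sphere_chart product_measure1E; [|exact: measurable_itv..].
by rewrite /= !lebesgue_measure_itv/=; do 2 case: ifP => _;
   rewrite ?mule0 ?mul0e// -?EFinD -?EFinM ltry.
Qed.

HB.instance Definition _ :=
  Measure_isFinite.Build _ _ _ (@surface_measure R) surface_measure_fin.

End surface_measure.

(** A configuration s of the spin triangle consists of the spins
    s_1 = s.1.1, s_2 = s.1.2, s_3 = s.2. *)
Notation spins R := (vec3 R * vec3 R * vec3 R)%type.

Definition phase_space (R : realType) : set (spins R) :=
  sphere2 R `*` sphere2 R `*` sphere2 R.
Arguments phase_space R : clear implicits.

(** The product of the surface measures; products are named so that they can
    carry a finite measure structure. *)
Definition surface_measure2 (R : realType) : set (vec3 R * vec3 R) -> \bar R :=
  (surface_measure \x surface_measure)%E.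
Arguments surface_measure2 R : clear implicits.

HB.instance Definition _ (R : realType) := Measure.on (surface_measure2 R).

Lemma surface_measure2_fin (R : realType) : fin_num_fun (surface_measure2 R).
Proof.
apply: lty_fin_num_fun; rewrite -setXTT.
rewrite [X in (X < _)%E](_ : _ = (@surface_measure R) setT * @surface_measure R setT)%E.
  by rewrite lte_mul_pinfty// -?ge0_fin_numE// fin_num_measure.
exact: product_measure1E.
Qed.

HB.instance Definition _ (R : realType) :=
  Measure_isFinite.Build _ _ _ (surface_measure2 R) (@surface_measure2_fin R).

Definition phase_volume (R : realType) : set (spins R) -> \bar R :=
  (surface_measure2 R \x surface_measure)%E.
Arguments phase_volume R : clear implicits.

HB.instance Definition _ (R : realType) := Measure.on (phase_volume R).

Lemma phase_volume_fin (R : realType) : fin_num_fun (phase_volume R).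
Proof.
apply: lty_fin_num_fun; rewrite -setXTT.
rewrite [X in (X < _)%E](_ : _ = (surface_measure2 R) setT * @surface_measure R setT)%E.
  by rewrite lte_mul_pinfty// -?ge0_fin_numE// fin_num_measure.
exact: product_measure1E.
Qed.

HB.instance Definition _ (R : realType) :=
  Measure_isFinite.Build _ _ _ (phase_volume R) (@phase_volume_fin R).

Definition hamiltonian {R : realType} (J1 J2 J3 : R) (s : spins R) : R :=
  J1 * dot3 s.1.2 s.2 + J2 * dot3 s.2 s.1.1 + J3 * dot3 s.1.1 s.1.2.

(** Third component of s_1 + s_2 + s_3. *)
Definition total_spin3 {R : realType} (s : spins R) : R :=
  s.1.1.2 + s.1.2.2 + s.2.2.

Definition field_hamiltonian {R : realType} (J1 J2 J3 B : R) (s : spins R) : R :=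
  hamiltonian J1 J2 J3 s - B * total_spin3 s.

Definition magnetization {R : realType} (J1 J2 J3 T B : R) : R :=
  let beta := 1 / T in
  (\int[phase_volume R]_(s in phase_space R)
      (total_spin3 s * expR (- beta * field_hamiltonian J1 J2 J3 B s))) /
  (\int[phase_volume R]_(s in phase_space R)
      expR (- beta * field_hamiltonian J1 J2 J3 B s)).

Definition susceptibility {R : realType} (J1 J2 J3 T : R) : R :=
  (magnetization J1 J2 J3 T)^`()%classic 0.

(* Main.v *)
Require Import Defs.
From mathcomp Require Import all_boot all_order all_algebra.
From mathcomp Require Import all_classical all_reals all_analysis.
From mathcomp Require Import measurable_realfun.
From mathcomp Require Import ring lra.
Import Order.TTheory GRing.Theory Num.Theory.
Import numFieldNormedType.Exports.
Set Implicit Arguments.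
Unset Strict Implicit.
Unset Printing Implicit Defensive.
Local Open Scope classical_set_scope.
Local Open Scope ring_scope.

(** Differentiating under the integral gives [T * chi = <(S^(3))^2> - <S^(3)>^2]
    with Gibbs averages at inverse temperature [1 / T].  If [L] is an
    infinitesimal rotation acting simultaneously on the three spins, then the
    integral of [L F] over the phase space vanishes; since [L] annihilates the
    Boltzmann weight [w], the choices [F = S^(1) * w] and
    [F = S^(1) * S^(3) * w] (and the same with [S^(2)]) yield [<S^(3)> = 0] and
    [<(S^(3))^2> = <|S|^2> / 3].  As [T] tends to infinity [<|S|^2>] tends to
    its uniform average [3].  As [T] tends to [0] the Gibbs measure concentrates
    on the ground states, where [|S|^2] is constant: it suffices to bound
    [| |S|^2 - g0 |] by [e + C * (H - min H)] for every [e > 0].  With the signs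
    of (ii) the ground states are collinear and [g0 = 1]; with those of (iii)
    the Hamiltonian is up to a constant a multiple of [|a1 s1 + a2 s2 + a3 s3|^2]
    and the ground states are the coplanar triples closing the triangle with
    sides [|a_i|]. *)

(** * Integration against image densities *)

Section density.
Context d d' (X : measurableType d) (Y : measurableType d') (R : realType).
Variables (la : {measure set X -> \bar R}) (nu : {measure set Y -> \bar R}).
Variables (D : set X) (phi : X -> Y) (h : X -> R).
Hypotheses (mD : measurable D) (mphi : measurable_fun setT phi).
Hypotheses (mh : measurable_fun setT h) (h0 : forall x, D x -> 0 <= h x).
Hypothesis nuE : forall A, measurable A ->
  nu A = (\int[la]_(x in D `&` phi @^-1` A) (h x)%:E)%E.

Import HBNNSimple.

Let integral_indic_density E : measurable E ->
  (\int[nu]_y (\1_E y)%:E = \int[la]_(x in D) (\1_E (phi x) * h x)%:E)%E.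
Proof.
move=> mE; rewrite integral_indic// setIT nuE// integral_mkcondr.
apply: eq_integral => x xD; rewrite patchE indicE.
have -> : (x \in phi @^-1` E) = (phi x \in E).
  by apply/idP/idP => /set_mem ?; apply/mem_set.
by case: ifP => _; rewrite ?mul1r ?mul0r.
Qed.

Let integral_nnsfun_density (f : {nnsfun Y >-> R}) :
  (\int[nu]_y (f y)%:E = \int[la]_(x in D) (f (phi x) * h x)%:E)%E.
Proof.
under [LHS]eq_integral do rewrite fimfunE -fsumEFin//.
rewrite [LHS]ge0_integral_fsum//; last 2 first.
  - by move=> r; exact/measurable_EFinP/measurableT_comp.
  - by move=> n x _; rewrite EFinM nnfun_muleindic_ge0.
have mi r : measurable_fun D (fun x => \1_(f @^-1` [set r]) (phi x) : R).
  by apply: measurable_funTS; exact: measurableT_comp.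
under [RHS]eq_integral.
  move=> x xD; rewrite EFinM fimfunE -fsumEFin// ge0_mule_fsuml; last first.
    by move=> r; rewrite EFinM nnfun_muleindic_ge0.
  over.
rewrite [RHS]ge0_integral_fsum//; last 2 first.
  - move=> r; apply: emeasurable_funM; apply/measurable_EFinP.
      by apply: measurable_funM => //; exact: mi.
    exact: measurable_funTS.
  - move=> n x Dx; rewrite mule_ge0//; last by rewrite lee_fin h0.
    by rewrite EFinM nnfun_muleindic_ge0.
apply: eq_fsbigr => r _.
(* Pulling [r] out of the integral requires [0 <= r]. A negative [r] is not a value of [f], so its
   preimage is empty and both summands vanish. *)
have [r0|r0] := ltP r 0.
  have fr : f @^-1` [set r] = set0.
    rewrite -subset0 => y /= fyr; have : 0 <= f y by [].
    by rewrite fyr leNgt r0.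
  by rewrite fr !integral0_eq// => x _; rewrite indic0 /= mulr0// mul0e.
under eq_integral do rewrite EFinM.
rewrite ge0_integralZl//; last first.
  by apply/measurable_EFinP; exact: measurable_indic.
rewrite integral_indic_density//.
under [in RHS]eq_integral do rewrite EFinM -muleA -EFinM EFinM.
rewrite ge0_integralZl//.
- apply/measurable_EFinP; apply: measurable_funM => //.
  exact: measurable_funTS.
- by move=> x Dx; rewrite lee_fin mulr_ge0// h0.
Qed.

Lemma ge0_integral_density (f : Y -> \bar R) :
  measurable_fun setT f -> (forall y, 0 <= f y)%E ->
  (\int[nu]_y f y = \int[la]_(x in D) (f (phi x) * (h x)%:E))%E.
Proof.
move=> mf f0.
pose f_ := nnsfun_approx measurableT mf.
transitivity (lim (\int[nu]_y (f_ n y)%:E @[n --> \oo])%E).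
  rewrite -monotone_convergence//=.
  - apply: eq_integral => ? /[!inE] xD; apply/esym/cvg_lim => //=.
    exact: cvg_nnsfun_approx.
  - by move=> n; exact/measurable_EFinP/measurable_funTS.
  - by move=> n ? _; rewrite lee_fin.
  - by move=> ? _ ? ? mn; rewrite lee_fin; exact/lefP/nd_nnsfun_approx.
under eq_fun do rewrite integral_nnsfun_density.
rewrite -monotone_convergence//=.
- apply: eq_integral => x /[!inE] xD; apply/cvg_lim => //.
  under eq_fun do rewrite EFinM.
  apply: cvgeZr => //.
  exact: cvg_nnsfun_approx.
- move=> n; apply/measurable_EFinP; apply: measurable_funTS.
  by apply: measurable_funM => //; exact: measurableT_comp.
- by move=> n x Dx; rewrite lee_fin mulr_ge0// h0.
- move=> x Dx m n mn; rewrite lee_fin ler_wpM2r ?h0//.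
  exact/lefP/nd_nnsfun_approx.
Qed.

End density.

Section signed_density.
Context d d' (X : measurableType d) (Y : measurableType d') (R : realType).
Variables (la : {measure set X -> \bar R}) (nu : {measure set Y -> \bar R}).
Variables (D : set X) (phi : X -> Y) (h : X -> R).
Hypotheses (mD : measurable D) (mphi : measurable_fun setT phi).
Hypotheses (mh : measurable_fun setT h) (h0 : forall x, D x -> 0 <= h x).
Hypothesis nuE : forall A, measurable A ->
  nu A = (\int[la]_(x in D `&` phi @^-1` A) (h x)%:E)%E.

(** Multiplication by [h >= 0] commutes with taking positive and negative parts, so the nonnegative
    case applies to each part separately. *)
Lemma integral_density (f : Y -> R) : measurable_fun setT f ->
  (\int[nu]_y (f y)%:E = \int[la]_(x in D) (f (phi x) * h x)%:E)%E.
Proof.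
move=> /measurable_EFinP mf; rewrite [LHS]integralE [RHS]integralE.
rewrite !(ge0_integral_density mD mphi mh h0 nuE)//;
  [|exact: measurable_funeneg|exact: measurable_funepos].
congr (_ - _)%E; apply: eq_integral => x /set_mem xD.
- by rewrite !funeposE -!EFin_max -EFinM maxr_pMl ?h0// mul0r.
- by rewrite !funenegE -!EFin_max -EFinM maxr_pMl ?h0// mul0r mulNr.
Qed.

End signed_density.

(** * Functions measurable everywhere and bounded on a set *)

Definition bounded_measurable {d} {T : measurableType d} {R : realType}
    (D : set T) (f : T -> R) :=
  measurable_fun setT f /\ exists M, forall x, D x -> `|f x| <= M.

Section bounded_measurable.
Context d (T : measurableType d) (R : realType) (D : set T).
Implicit Types f g : T -> R.
Local Notation bm := (@bounded_measurable _ T R D).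

Lemma bounded_measurable_cst (r : R) : bm (fun=> r).
Proof. by split; [exact: measurable_cst|exists `|r|]. Qed.

Lemma bounded_measurableD f g : bm f -> bm g -> bm (fun x => f x + g x).
Proof.
move=> [mf [M fM]] [mg [N gN]]; split; first exact: measurable_funD.
by exists (M + N) => x Dx; rewrite (le_trans (ler_normD _ _))// lerD ?fM ?gN.
Qed.

Lemma bounded_measurableN f : bm f -> bm (fun x => - f x).
Proof.
move=> [mf [M fM]]; split; first exact: measurableT_comp.
by exists M => x Dx; rewrite normrN fM.
Qed.

Lemma bounded_measurableB f g : bm f -> bm g -> bm (fun x => f x - g x).
Proof.
by move=> bf bg; apply: bounded_measurableD => //; exact: bounded_measurableN.
Qed.

Lemma bounded_measurableM f g : bm f -> bm g -> bm (fun x => f x * g x).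
Proof.
move=> [mf [M fM]] [mg [N gN]]; split; first exact: measurable_funM.
by exists (M * N) => x Dx; rewrite normrM ler_pM ?fM ?gN.
Qed.

Lemma bounded_measurableX f n : bm f -> bm (fun x => f x ^+ n).
Proof.
move=> [mf [M fM]]; split; first exact: measurable_funX.
by exists (M ^+ n) => x Dx; rewrite normrX lerXn2r ?nnegrE ?fM// (le_trans _ (fM x Dx)).
Qed.

Lemma bounded_measurable_expR f : bm f -> bm (fun x => expR (f x)).
Proof.
move=> [mf [M fM]]; split; first exact: measurableT_comp.
exists (expR M) => x Dx; rewrite ger0_norm ?expR_ge0// ler_expR.
by rewrite (le_trans (ler_norm _))// fM.
Qed.

Lemma bounded_measurable_sin f : measurable_fun setT f ->
  bm (fun x => sin (f x)).
Proof.
move=> mf; split.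
  apply: measurableT_comp => //.
  by apply: continuous_measurable_fun; exact: continuous_sin.
by exists 1 => x _; rewrite ler_norml sin_geN1 sin_le1.
Qed.

Lemma bounded_measurable_cos f : measurable_fun setT f ->
  bm (fun x => cos (f x)).
Proof.
move=> mf; split.
  apply: measurableT_comp => //.
  by apply: continuous_measurable_fun; exact: continuous_cos.
by exists 1 => x _; rewrite ler_norml cos_geN1 cos_le1.
Qed.

(** All measures below are finite on the sets of interest, so this discharges the integrability
    conditions of Fubini, of linearity and of differentiation under the integral. *)
Lemma bounded_measurable_integrable (mu : {measure set T -> \bar R}) f :
  measurable D -> (mu D < +oo)%E -> bm f -> mu.-integrable D (EFin \o f).
Proof.
move=> mD muD [mf [M fM]]; apply: measurable_bounded_integrable => //.
  exact: measurable_funTS.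
exists M; split; first exact: num_real.
by move=> N MN x Dx /=; rewrite (le_trans (fM x Dx))// ltW.
Qed.

End bounded_measurable.

Lemma bounded_measurable_comp d d' (T : measurableType d)
    (U : measurableType d') (R : realType) (D : set T) (E : set U)
    (phi : U -> T) (f : T -> R) : measurable_fun setT phi ->
  (forall u, E u -> D (phi u)) -> bounded_measurable D f ->
  bounded_measurable E (fun u => f (phi u)).
Proof.
move=> mphi phiD [mf [M fM]]; split; first exact: measurableT_comp.
by exists M => u Eu; exact/fM/phiD.
Qed.

(** * Fubini for integrands with vanishing slices *)

Section null_slices.
Context d1 d2 (T1 : measurableType d1) (T2 : measurableType d2) (R : realType).
Variables (m1 : {sigma_finite_measure set T1 -> \bar R})
          (m2 : {sigma_finite_measure set T2 -> \bar R}).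
Variables (A : set T1) (B : set T2) (f : T1 * T2 -> R).
Hypotheses (mA : measurable A) (mB : measurable B).
Hypothesis intf : (m1 \x m2)%E.-integrable (A `*` B) (EFin \o f).

Let intfAB : (m1 \x m2)%E.-integrable setT ((EFin \o f) \_ (A `*` B)).
Proof. by apply/(integrable_mkcond _ _).1 => //; exact: measurableX. Qed.

(** Fubini is applied to the integrand extended by zero to the whole product: slices outside [A]
    vanish trivially, those inside by hypothesis. *)
Lemma integral_null_xsections :
  (forall x, A x -> \int[m2]_(y in B) (f (x, y))%:E = 0)%E ->
  (\int[m1 \x m2]_(z in A `*` B) (f z)%:E = 0)%E.
Proof.
move=> f0; rewrite integral_mkcond -(integral12_prod_meas1 intfAB).
apply: integral0_eq => x _; rewrite /fubini_F.
have [Ax|nAx] := pselect (A x); last first.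
  apply: integral0_eq => y _; rewrite patchE ifF//.
  by apply/negP => /set_mem [].
rewrite -(f0 _ Ax) [RHS]integral_mkcond; apply: eq_integral => y _.
rewrite !patchE; congr (if _ then _ else _).
by apply/idP/idP => /set_mem H; apply/mem_set => //; case: H.
Qed.

Lemma integral_null_ysections :
  (forall y, B y -> \int[m1]_(x in A) (f (x, y))%:E = 0)%E ->
  (\int[m1 \x m2]_(z in A `*` B) (f z)%:E = 0)%E.
Proof.
move=> f0; rewrite integral_mkcond -(integral21_prod_meas1 intfAB).
apply: integral0_eq => y _; rewrite /fubini_G.
have [By|nBy] := pselect (B y); last first.
  apply: integral0_eq => x _; rewrite patchE ifF//.
  by apply/negP => /set_mem [].
rewrite -(f0 _ By) [RHS]integral_mkcond; apply: eq_integral => x _.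
rewrite !patchE; congr (if _ then _ else _).
by apply/idP/idP => /set_mem H; apply/mem_set => //; case: H.
Qed.

End null_slices.

(** * Trigonometric integrands in one angle *)

Section trig_linear.
Context {R : realType}.

(** With one spherical angle frozen, every affine function of a point of the sphere takes this form
    in the other angle. *)
Definition trig_linear (v : R * R * R) (x : R) : R :=
  v.1.1 + v.1.2 * sin x + v.2 * cos x.

Definition trig_linear' (v : R * R * R) (x : R) : R :=
  v.1.2 * cos x - v.2 * sin x.

(** The first factor will be the coefficient of the rotation field in the given angle, the next two
    are affine observables, and the exponential is the Boltzmann weight. *)
Definition trig_prod_exp (v0 v1 v2 v3 : R * R * R) (x : R) : R :=
  trig_linear v0 x * trig_linear v1 x * trig_linear v2 x
  * expR (trig_linear v3 x).

Definition trig_prod_exp' (v0 v1 v2 v3 : R * R * R) (x : R) : R :=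
  (trig_linear' v0 x * trig_linear v1 x * trig_linear v2 x
   + trig_linear v0 x * trig_linear' v1 x * trig_linear v2 x
   + trig_linear v0 x * trig_linear v1 x * trig_linear' v2 x
   + trig_linear v0 x * trig_linear v1 x * trig_linear v2 x * trig_linear' v3 x)
  * expR (trig_linear v3 x).

Lemma is_derive_trig_linear v (x : R) :
  is_derive x 1 (trig_linear v) (trig_linear' v x).
Proof.
have d0 : is_derive x 1 (cst v.1.1 : R -> R) 0 by exact: is_derive_cst.
have d1 : is_derive x 1 (v.1.2 *: @sin R) (v.1.2 *: cos x) by exact: is_deriveZ.
have d2 : is_derive x 1 (v.2 *: @cos R) (v.2 *: - sin x) by exact: is_deriveZ.
rewrite (_ : trig_linear' v x = 0 + v.1.2 *: cos x + v.2 *: - sin x).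
  exact: is_deriveD (is_deriveD d0 d1) d2.
by rewrite /trig_linear' /GRing.scale/= add0r mulrN.
Qed.

Lemma trig_linear_periodic v : trig_linear v (pi *+ 2) = trig_linear v 0.
Proof. by rewrite /trig_linear sin0 cos0 cos2pi sin2pi. Qed.

Lemma integral_trig_prod_exp' v0 v1 v2 v3 (L : R) : 0 < L ->
  (\int[lebesgue_measure]_(x in `[0%R, L]) (trig_prod_exp' v0 v1 v2 v3 x)%:E
   = (trig_prod_exp v0 v1 v2 v3 L)%:E - (trig_prod_exp v0 v1 v2 v3 0)%:E)%E.
Proof.
move=> L0.
have dl v (x : R) : is_derive x 1 (trig_linear v) (trig_linear' v x).
  exact: is_derive_trig_linear.
have cl v (x : R) : {for x, continuous (trig_linear v)}.
  by apply: differentiable_continuous; apply/derivable1_diffP.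
have cl' v (x : R) : {for x, continuous (trig_linear' v)}.
  have -> : trig_linear' v = trig_linear (0, - v.2, v.1.2).
    by apply/funext => y; rewrite /trig_linear /trig_linear'/=; ring.
  exact: cl.
pose F : R -> R := trig_linear v0 * trig_linear v1 * trig_linear v2
  * (expR \o trig_linear v3).
have dF (x : R) : is_derive x 1 F (trig_prod_exp' v0 v1 v2 v3 x).
  apply: is_derive_eq.
  by rewrite /GRing.scale/= !fctE /trig_prod_exp'; ring.
have -> : trig_prod_exp v0 v1 v2 v3 = F by [].
rewrite (@continuous_FTC2 _ _ F)//.
- apply: continuous_subspaceT => x.
  have cM (f g : R -> R) : {for x, continuous f} -> {for x, continuous g} ->
    {for x, continuous (f \* g)} by exact: cvgM.
  have cD (f g : R -> R) : {for x, continuous f} -> {for x, continuous g} ->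
    {for x, continuous (f \+ g)} by exact: cvgD.
  have cP v w z (f g h : (R * R * R) -> R -> R) : {for x, continuous (f v)} ->
      {for x, continuous (g w)} -> {for x, continuous (h z)} ->
      {for x, continuous (f v \* g w \* h z)}.
    by move=> ? ? ?; apply: (cM _ _ (cM _ _ _ _)).
  have c3 : {for x, continuous (expR \o trig_linear v3)}.
    by apply: continuous_comp; [exact: cl|exact: continuous_expR].
  apply: (cM _ _ _ c3); apply: (cD _ _ (cD _ _ (cD _ _ _ _) _) _).
  - exact: cP.
  - exact: cP.
  - exact: cP.
  - by apply: cM => //; exact: cP.
- have cF (x : R) : continuous_at x F.
    by apply: differentiable_continuous; apply/derivable1_diffP.
  split.
  + by move=> x _.
  + by apply: cvg_at_right_filter; exact: cF.
  + by apply: cvg_at_left_filter; exact: cF.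
- move=> x _; rewrite derive1E; exact: derive_val.
Qed.

End trig_linear.

(** * Rotations of the unit sphere *)

Section sphere.
Context {R : realType}.

Lemma dot3_sphere_param (u : vec2 R) :
  dot3 (sphere_param u) (sphere_param u) = 1.
Proof.
rewrite /dot3 /sphere_param/= -!expr2 !exprMn -mulrDr cos2Dsin2 mulr1.
by rewrite addrC cos2Dsin2.
Qed.

Lemma measurable_dot3 d (T : measurableType d) (f g : T -> vec3 R) :
  measurable_fun setT f -> measurable_fun setT g ->
  measurable_fun setT (fun x => dot3 (f x) (g x)).
Proof.
move=> /measurable_fun_pairP[/measurable_fun_pairP[f1 f2] f3].
move=> /measurable_fun_pairP[/measurable_fun_pairP[g1 g2] g3].
by apply: measurable_funD; [apply: measurable_funD|]; apply: measurable_funM.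
Qed.

Lemma measurable_sphere2 : measurable (sphere2 R).
Proof.
rewrite -[X in measurable X]setTI.
have mdot : measurable_fun setT (fun s : vec3 R => dot3 s s).
  exact: measurable_dot3.
have := mdot measurableT _ (measurable_set1 (1 : R)); exact.
Qed.

(** [surface_measure] has density [sin u.1] along [sphere_param] by definition. The restriction to
    the sphere disappears because every [sphere_param u] lies on it. *)
Lemma integral_surface_measure (f : vec3 R -> R) : measurable_fun setT f ->
  (\int[surface_measure]_(s in sphere2 R) (f s)%:E =
   \int[lebesgue_measure \x lebesgue_measure]_(u in sphere_chart R)
     (f (sphere_param u) * sin u.1)%:E)%E.
Proof.
move=> mf; rewrite integral_mkcond.
under eq_integral do rewrite restrict_EFin.
rewrite (@integral_density _ _ _ _ R (lebesgue_measure \x lebesgue_measure)%E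
  surface_measure (sphere_chart R) sphere_param (fun u => sin u.1)
  _ _ _ _ _ (f \_ (sphere2 R)))//.
- apply: eq_integral => u _; rewrite patchE mem_set//.
  exact: dot3_sphere_param.
- exact: measurable_sphere_chart.
- exact: measurable_sphere_param.
- apply: (@measurableT_comp _ _ _ _ _ _ (@sin R) _ fst) => //.
  by apply: continuous_measurable_fun; exact: continuous_sin.
- exact: sphere_element_ge0.
- by apply/(measurable_restrictT _ _).1; [exact: measurable_sphere2|exact: measurable_funTS].
Qed.


Definition bounded_measurable3 d (T : measurableType d) (D : set T)
    (v : T -> R * R * R) :=
  [/\ bounded_measurable D (fun x => (v x).1.1),
      bounded_measurable D (fun x => (v x).1.2) &
      bounded_measurable D (fun x => (v x).2)].

Lemma bounded_measurable_trig_prod_exp' d (T : measurableType d) (D : set T)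
    (v0 v1 v2 v3 : T -> R * R * R) (f : T -> R) :
  bounded_measurable3 D v0 -> bounded_measurable3 D v1 ->
  bounded_measurable3 D v2 -> bounded_measurable3 D v3 ->
  measurable_fun setT f ->
  bounded_measurable D (fun x => trig_prod_exp' (v0 x) (v1 x) (v2 x) (v3 x) (f x)).
Proof.
move=> b0 b1 b2 b3 mf; have bs := bounded_measurable_sin D mf.
have bc := bounded_measurable_cos D mf.
have bl v : bounded_measurable3 D v ->
    bounded_measurable D (fun x => trig_linear (v x) (f x)).
  move=> [? ? ?]; apply: bounded_measurableD.
    by apply: bounded_measurableD => //; exact: bounded_measurableM.
  exact: bounded_measurableM.
have bl' v : bounded_measurable3 D v ->
    bounded_measurable D (fun x => trig_linear' (v x) (f x)).
  by move=> [? ? ?]; apply: bounded_measurableB; exact: bounded_measurableM.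
move: (bl _ b0) (bl _ b1) (bl _ b2) (bl _ b3) => l0 l1 l2 l3.
move: (bl' _ b0) (bl' _ b1) (bl' _ b2) (bl' _ b3) => d0 d1 d2 d3.
apply: bounded_measurableM; last exact: bounded_measurable_expR.
apply: bounded_measurableD; last by do 3 apply: bounded_measurableM => //.
by do 2 ?apply: bounded_measurableD; do 2 apply: bounded_measurableM => //.
Qed.

(* The infinitesimal rotation turning the third axis towards [(p, q, 0)]. *)
Definition rotation_field (p q : R) (s : vec3 R) : vec3 R :=
  (p * s.2, q * s.2, - (p * s.1.1 + q * s.1.2)).

(* The derivative of [(a + P . s) * (c + Q . s) * exp (r + k . s)] along the
   rotation field. *)
Definition rotation_derivative (a c r : R) (P Q k : vec3 R) (p q : R)
    (s : vec3 R) : R :=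
  let l := rotation_field p q s in
  (dot3 P l * (c + dot3 Q s) + (a + dot3 P s) * dot3 Q l
   + (a + dot3 P s) * (c + dot3 Q s) * dot3 k l) * expR (r + dot3 k s).

Lemma measurable_rotation_derivative a c r P Q k p q :
  measurable_fun setT (rotation_derivative a c r P Q k p q).
Proof.
have ml : measurable_fun setT (rotation_field p q).
  have m3 : measurable_fun setT (snd : vec3 R -> measurableTypeR R).
    exact: measurable_snd.
  have m1 : measurable_fun setT (fun s : vec3 R => s.1.1).
    exact: (measurableT_comp measurable_fst measurable_fst).
  have m2 : measurable_fun setT (fun s : vec3 R => s.1.2).
    exact: (measurableT_comp measurable_snd measurable_fst).
  apply/measurable_fun_pairP; split; last first.
    suff : measurable_fun setT (fun s : vec3 R => p * s.1.1 + q * s.1.2).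
      by move=> mf; exact: measurable_funN.
    by apply: measurable_funD; apply: measurable_funM.
  by apply/measurable_fun_pairP; split; apply: measurable_funM.
have md (v : vec3 R) (f : vec3 R -> vec3 R) : measurable_fun setT f ->
    measurable_fun setT (fun s => dot3 v (f s)).
  by move=> mf; exact: measurable_dot3.
have m0 (r' : R) (v : vec3 R) : measurable_fun setT (fun s => r' + dot3 v s).
  by apply: measurable_funD => //; exact: md.
apply: measurable_funM; last by apply: measurableT_comp => //; exact: m0.
apply: measurable_funD; last first.
  apply: measurable_funM; last exact: md.
  by apply: measurable_funM; exact: m0.
by apply: measurable_funD; apply: measurable_funM => //; exact: md.
Qed.

(* In spherical coordinates [sin theta] times the rotated derivative of [f] is
   the divergence of [(sin theta * h * f, cos theta * h' * f)], where
   [h phi = p cos phi + q sin phi]. *)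
Lemma integral_rotation_derivative a c r P Q k p q :
  (\int[surface_measure]_(s in sphere2 R)
    (rotation_derivative a c r P Q k p q s)%:E = 0)%E.
Proof.
rewrite integral_surface_measure; last exact: measurable_rotation_derivative.
(* [T0] and [T] hold the coefficients in the polar angle with the azimuth frozen, [F0] and [F] those
   in the azimuth with the polar angle frozen. Thus [g1] and [g2] are the two partial derivatives
   that make up the divergence. *)
pose T0 (u : vec2 R) := (0 : R, p * cos u.2 + q * sin u.2, 0 : R).
pose T (a : R) (P : vec3 R) (u : vec2 R) :=
  (a, P.1.1 * cos u.2 + P.1.2 * sin u.2, P.2 : R).
pose F0 (u : vec2 R) := (0 : R, - (p * cos u.1), q * cos u.1).
pose F (a : R) (P : vec3 R) (u : vec2 R) :=
  (a + P.2 * cos u.1, P.1.2 * sin u.1, P.1.1 * sin u.1).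
pose g1 u := trig_prod_exp' (T0 u) (T a P u) (T c Q u) (T r k u) u.1.
pose g2 u := trig_prod_exp' (F0 u) (F a P u) (F c Q u) (F r k u) u.2.
have gE u : rotation_derivative a c r P Q k p q (sphere_param u) * sin u.1
    = g1 u + g2 u.
  rewrite /rotation_derivative /g1 /g2 /trig_prod_exp'.
  have -> : r + dot3 k (sphere_param u) = trig_linear (T r k u) u.1.
    by rewrite /dot3 /trig_linear /sphere_param /=; ring.
  have -> : trig_linear (F r k u) u.2 = trig_linear (T r k u) u.1.
    by rewrite /trig_linear/=; ring.
  rewrite -mulrDl mulrAC; congr (_ * _).
  rewrite /trig_linear /trig_linear' /rotation_field /sphere_param /dot3 /=.
  set S := sin u.1; set C := cos u.1; set s := sin u.2.
  have : cos u.2 * cos u.2 = 1 - s * s.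
    by rewrite -!expr2 -(cos2Dsin2 u.2) addrK.
  set e := cos u.2 => ee.
  have e0 : 1 - s * s - e * e = 0 by rewrite ee subrr.
  apply/eqP; rewrite -subr_eq0; apply/eqP.
  set x := S * e; set y := S * s.
  pose A := a + (P.1.1 * x + P.1.2 * y + P.2 * C).
  pose B := c + (Q.1.1 * x + Q.1.2 * y + Q.2 * C).
  (* The two sides agree only modulo the Pythagorean relation for the azimuth; this is their
     difference with that relation factored out. *)
  transitivity ((p * (P.1.1 * B + A * Q.1.1 + A * B * k.1.1)
    + q * (P.1.2 * B + A * Q.1.2 + A * B * k.1.2)) * S * C * (1 - s * s - e * e)).
    by rewrite /A /B /x /y; ring.
  by rewrite e0 mulr0.
under eq_integral do rewrite gE.
have m1 : measurable_fun setT (fst : vec2 R -> R) by exact: measurable_fst.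
have m2 : measurable_fun setT (snd : vec2 R -> R) by exact: measurable_snd.
have bc (b : R) := @bounded_measurable_cst _ (vec2 R) R (sphere_chart R) b.
have bs1 := bounded_measurable_sin (sphere_chart R) m1.
have bs2 := bounded_measurable_sin (sphere_chart R) m2.
have bc1 := bounded_measurable_cos (sphere_chart R) m1.
have bc2 := bounded_measurable_cos (sphere_chart R) m2.
have bg1 : bounded_measurable (sphere_chart R) g1.
  have bT b V : bounded_measurable3 (sphere_chart R) (T b V).
    split=> /=; [exact: bc| |exact: bc].
    by apply: bounded_measurableD; apply: bounded_measurableM.
  apply: bounded_measurable_trig_prod_exp' => //.
  exact: (bT 0 (p, q, 0)).
have bg2 : bounded_measurable (sphere_chart R) g2.
  have bF b V : bounded_measurable3 (sphere_chart R) (F b V).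
    split=> /=; [|exact: bounded_measurableM..].
    by apply: bounded_measurableD => //; apply: bounded_measurableM.
  apply: bounded_measurable_trig_prod_exp' => //.
  split=> /=; [exact: bc| |exact: bounded_measurableM].
  by apply: bounded_measurableN; exact: bounded_measurableM.
have fin : ((lebesgue_measure \x lebesgue_measure) (sphere_chart R) < +oo)%E.
  rewrite /sphere_chart product_measure1E; [|exact: measurable_itv..].
  rewrite /= !lebesgue_measure_itv/=; do 2 case: ifP => _;
    by rewrite ?mule0 ?mul0e// -?EFinD -?EFinM ltry.
have int g' : bounded_measurable (sphere_chart R) g' ->
    (lebesgue_measure \x lebesgue_measure)%E.-integrable (sphere_chart R) (EFin \o g').
  by move=> bg'; apply: bounded_measurable_integrable => //; exact: measurable_sphere_chart.
rewrite integralD_EFin; [|exact: measurable_sphere_chart|exact: int|exact: int].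
rewrite (_ : (\int[_]_(x in _) (g1 x)%:E)%E = 0%E); last first.
  apply: integral_null_ysections => //.
  - exact: int.
  - move=> y _.
    (* The [0] in [(0, y)] is a dummy, since [T0] and [T] depend on the azimuth alone. The boundary
       terms at the poles carry the factor [sin], which vanishes there; in the azimuth they will
       cancel by periodicity. *)
    have K := integral_trig_prod_exp' (T0 (0, y)) (T a P (0, y)) (T c Q (0, y))
      (T r k (0, y)) (pi_gt0 R).
    apply: (etrans K).
    have K0 x : sin x = 0 -> trig_linear (T0 (0, y)) x = 0.
      by move=> x0; rewrite /trig_linear /= x0 !mulr0 mul0r !addr0.
    rewrite /trig_prod_exp (K0 pi) ?sinpi// (K0 0) ?sin0//.
    by rewrite !mul0r subee.
rewrite (_ : (\int[_]_(x in _) (g2 x)%:E)%E = 0%E) ?adde0//.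
apply: integral_null_xsections => //.
- exact: int.
- move=> x _.
  have pi2 : 0 < pi *+ 2 :> R by rewrite mulrn_wgt0 ?pi_gt0.
  have K := integral_trig_prod_exp' (F0 (x, 0)) (F a P (x, 0)) (F c Q (x, 0))
    (F r k (x, 0)) pi2.
  apply: (etrans K).
  by rewrite /trig_prod_exp !trig_linear_periodic subee.
Qed.

End sphere.

(** * Integrals over the phase space *)

Section phase_space.
Context {R : realType}.

Lemma measurable_phase_space : measurable (phase_space R).
Proof. by do 2 ?apply: measurableX; exact: measurable_sphere2. Qed.

Lemma phase_volume_lty (A : set (spins R)) : measurable A ->
  (phase_volume R A < +oo)%E.
Proof. by move=> mA; rewrite -ge0_fin_numE//; exact: fin_num_measure. Qed.

Lemma integrable_phase_space (f : spins R -> R) :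
  bounded_measurable (phase_space R) f ->
  (phase_volume R).-integrable (phase_space R) (EFin \o f).
Proof.
move=> bf; apply: bounded_measurable_integrable => //.
- exact: measurable_phase_space.
- by apply: phase_volume_lty; exact: measurable_phase_space.
Qed.

Definition phase_integral (f : spins R -> R) : R :=
  \int[phase_volume R]_(s in phase_space R) f s.

Local Notation bm := (bounded_measurable (phase_space R)).

Lemma eq_phase_integral (f g : spins R -> R) :
  (forall s, phase_space R s -> f s = g s) ->
  phase_integral f = phase_integral g.
Proof. by move=> fg; apply: eq_Rintegral => s /set_mem; exact: fg. Qed.

Lemma phase_integralD (f g : spins R -> R) : bm f -> bm g ->
  phase_integral (fun s => f s + g s) = phase_integral f + phase_integral g.
Proof.
move=> bf bg; apply: RintegralD; first exact: measurable_phase_space.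
  exact: integrable_phase_space.
exact: integrable_phase_space.
Qed.

Lemma phase_integralZ (r : R) (f : spins R -> R) : bm f ->
  phase_integral (fun s => r * f s) = r * phase_integral f.
Proof.
move=> bf; apply: RintegralZl; first exact: measurable_phase_space.
exact: integrable_phase_space.
Qed.

Lemma le_phase_integral (f g : spins R -> R) : bm f -> bm g ->
  (forall s, phase_space R s -> f s <= g s) ->
  phase_integral f <= phase_integral g.
Proof.
move=> bf bg fg; apply: le_Rintegral => //; first exact: measurable_phase_space.
  exact: integrable_phase_space.
exact: integrable_phase_space.
Qed.

(** This and its two companions reduce a vanishing phase space integral to the integral over a
    single spin with the other two fixed. The third spin is the outer factor of the nested product,
    so one use of Fubini suffices here; the other sites take two. *)
Lemma integral_phase_space0_site3 (f : spins R -> R) :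
  bounded_measurable (phase_space R) f ->
  (forall s1 s2, sphere2 R s1 -> sphere2 R s2 ->
    \int[surface_measure]_(s in sphere2 R) (f (s1, s2, s))%:E = 0)%E ->
  phase_integral f = 0.
Proof.
move=> bf f0; rewrite /phase_integral /Rintegral (_ : integral _ _ _ = 0%E)//.
apply: integral_null_xsections.
- by apply: measurableX; exact: measurable_sphere2.
- exact: measurable_sphere2.
- exact: integrable_phase_space.
- by move=> [s1 s2] [S1 S2]; exact: f0.
Qed.

Let integrable_slice (f : spins R -> R) (s3 : vec3 R) : sphere2 R s3 ->
  bounded_measurable (phase_space R) f ->
  (surface_measure2 R).-integrable (sphere2 R `*` sphere2 R)
    (EFin \o (fun s => f (s, s3))).
Proof.
move=> S3 bf; apply: bounded_measurable_integrable.
- by apply: measurableX; exact: measurable_sphere2.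
- rewrite -ge0_fin_numE//; apply: fin_num_measure.
  by apply: measurableX; exact: measurable_sphere2.
- by apply: bounded_measurable_comp bf => //; exact: measurable_pair2.
Qed.

Lemma integral_phase_space0_site2 (f : spins R -> R) :
  bounded_measurable (phase_space R) f ->
  (forall s1 s3, sphere2 R s1 -> sphere2 R s3 ->
    \int[surface_measure]_(s in sphere2 R) (f (s1, s, s3))%:E = 0)%E ->
  phase_integral f = 0.
Proof.
move=> bf f0; rewrite /phase_integral /Rintegral (_ : integral _ _ _ = 0%E)//.
apply: integral_null_ysections.
- by apply: measurableX; exact: measurable_sphere2.
- exact: measurable_sphere2.
- exact: integrable_phase_space.
- move=> s3 S3; apply: integral_null_xsections.
  + exact: measurable_sphere2.
  + exact: measurable_sphere2.
  + exact: integrable_slice.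
  + by move=> s1 S1; exact: f0.
Qed.

Lemma integral_phase_space0_site1 (f : spins R -> R) :
  bounded_measurable (phase_space R) f ->
  (forall s2 s3, sphere2 R s2 -> sphere2 R s3 ->
    \int[surface_measure]_(s in sphere2 R) (f (s, s2, s3))%:E = 0)%E ->
  phase_integral f = 0.
Proof.
move=> bf f0; rewrite /phase_integral /Rintegral (_ : integral _ _ _ = 0%E)//.
apply: integral_null_ysections.
- by apply: measurableX; exact: measurable_sphere2.
- exact: measurable_sphere2.
- exact: integrable_phase_space.
- move=> s3 S3; apply: integral_null_ysections.
  + exact: measurable_sphere2.
  + exact: measurable_sphere2.
  + exact: integrable_slice.
  + by move=> s2 S2; exact: f0.
Qed.

End phase_space.

(** * Rotation invariance of Gibbs integrals *)

Section rotation_invariance.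
Context {R : realType}.

Definition comb3 (a : R) (u : vec3 R) (b : R) (v : vec3 R) : vec3 R :=
  (a * u.1.1 + b * v.1.1, a * u.1.2 + b * v.1.2, a * u.2 + b * v.2).

Section bounded.
Context d (T : measurableType d) (D : set T).
Implicit Types u v : T -> vec3 R.

Lemma bounded_measurable3_cst (v : vec3 R) :
  bounded_measurable3 D (fun=> v).
Proof. by split; exact: bounded_measurable_cst. Qed.

Lemma bounded_measurable3_comb3 u v a b : bounded_measurable3 D u ->
  bounded_measurable3 D v ->
  bounded_measurable3 D (fun x => comb3 a (u x) b (v x)).
Proof.
have bc (r : R) := @bounded_measurable_cst _ T R D r.
move=> [? ? ?] [? ? ?]; split => /=;
  by apply: bounded_measurableD; apply: bounded_measurableM.
Qed.

Lemma bounded_measurable3_rotation_field v p q : bounded_measurable3 D v ->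
  bounded_measurable3 D (fun x => rotation_field p q (v x)).
Proof.
have bc (r : R) := @bounded_measurable_cst _ T R D r.
move=> [? ? ?]; split => /=; [exact: bounded_measurableM..|].
by apply: bounded_measurableN; apply: bounded_measurableD;
  exact: bounded_measurableM.
Qed.

Lemma bounded_measurable_dot3 u v : bounded_measurable3 D u ->
  bounded_measurable3 D v -> bounded_measurable D (fun x => dot3 (u x) (v x)).
Proof.
move=> [? ? ?] [? ? ?].
apply: bounded_measurableD; last exact: bounded_measurableM.
by apply: bounded_measurableD; exact: bounded_measurableM.
Qed.

Lemma bounded_measurable_rotation_derivative (a c r : T -> R) P Q k p q s :
  bounded_measurable D a -> bounded_measurable D c -> bounded_measurable D r ->
  bounded_measurable3 D k -> bounded_measurable3 D s ->
  bounded_measurable D (fun x =>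
    rotation_derivative (a x) (c x) (r x) P Q (k x) p q (s x)).
Proof.
move=> ba bc br bk bs; have bl := bounded_measurable3_rotation_field p q bs.
have bdc (v : vec3 R) u : bounded_measurable3 D u ->
    bounded_measurable D (fun x => dot3 v (u x)).
  by apply: bounded_measurable_dot3; exact: bounded_measurable3_cst.
apply: bounded_measurableM; last first.
  apply: bounded_measurable_expR; apply: bounded_measurableD => //.
  exact: bounded_measurable_dot3.
have ? := bounded_measurableD ba (bdc P _ bs).
have ? := bounded_measurableD bc (bdc Q _ bs).
apply: bounded_measurableD; last first.
  apply: bounded_measurableM; first exact: bounded_measurableM.
  exact: bounded_measurable_dot3.
by apply: bounded_measurableD; apply: bounded_measurableM => //; exact: bdc.
Qed.

End bounded.

Lemma bounded_measurable3_sphere d (T : measurableType d) (D : set T)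
    (v : T -> vec3 R) : measurable_fun setT v ->
  (forall x, D x -> sphere2 R (v x)) -> bounded_measurable3 D v.
Proof.
move=> /measurable_fun_pairP[/measurable_fun_pairP[m1 m2] m3] vS.
have sq1 (x y z : R) : x * x + y * y + z * z = 1 ->
    [/\ `|x| <= 1, `|y| <= 1 & `|z| <= 1].
  by move=> e; rewrite !ler_norml; split; nra.
by split; (split; [done | exists 1 => x /vS /sq1[]]).
Qed.

Lemma bounded_measurable3_site1 :
  bounded_measurable3 (phase_space R) (fun s : spins R => s.1.1).
Proof.
apply: bounded_measurable3_sphere; last by move=> ? [[]].
exact: (measurableT_comp measurable_fst measurable_fst).
Qed.

Lemma bounded_measurable3_site2 :
  bounded_measurable3 (phase_space R) (fun s : spins R => s.1.2).
Proof.
apply: bounded_measurable3_sphere; last by move=> ? [[]].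
exact: (measurableT_comp measurable_snd measurable_fst).
Qed.

Lemma bounded_measurable3_site3 :
  bounded_measurable3 (phase_space R) (fun s : spins R => s.2).
Proof.
by apply: bounded_measurable3_sphere; [exact: measurable_snd|move=> ? []].
Qed.

Definition total_spin (s : spins R) : vec3 R :=
  comb3 1 (comb3 1 s.1.1 1 s.1.2) 1 s.2.

(** The observable being rotated is [dot3 P S * (c + dot3 Q S)] times the Boltzmann weight. As a
    function of one spin it has the shape handled by [rotation_derivative], so each single-site
    derivative [G1], [G2], [G3] integrates to zero; their sum is the derivative along the
    simultaneous rotation. *)
Lemma integral_rotated_observable (J1 J2 J3 b c : R) (P Q : vec3 R) (p q : R) :
  phase_integral (fun s =>
    (let S := total_spin s in let L := rotation_field p q S in
     dot3 P L * (c + dot3 Q S) + dot3 P S * dot3 Q L)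
     * expR (- b * hamiltonian J1 J2 J3 s)) = 0.
Proof.
pose G1 (s : spins R) := rotation_derivative
  (dot3 P (comb3 1 s.1.2 1 s.2)) (c + dot3 Q (comb3 1 s.1.2 1 s.2))
  (- (b * J1) * dot3 s.1.2 s.2) P Q
  (comb3 (- (b * J3)) s.1.2 (- (b * J2)) s.2) p q s.1.1.
pose G2 (s : spins R) := rotation_derivative
  (dot3 P (comb3 1 s.1.1 1 s.2)) (c + dot3 Q (comb3 1 s.1.1 1 s.2))
  (- (b * J2) * dot3 s.2 s.1.1) P Q
  (comb3 (- (b * J3)) s.1.1 (- (b * J1)) s.2) p q s.1.2.
pose G3 (s : spins R) := rotation_derivative
  (dot3 P (comb3 1 s.1.1 1 s.1.2)) (c + dot3 Q (comb3 1 s.1.1 1 s.1.2))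
  (- (b * J3) * dot3 s.1.1 s.1.2) P Q
  (comb3 (- (b * J2)) s.1.1 (- (b * J1)) s.1.2) p q s.2.
have b1 := bounded_measurable3_site1.
have b2 := bounded_measurable3_site2.
have b3 := bounded_measurable3_site3.
have bG (a' c' k' : R) (u v w : spins R -> vec3 R) :
    bounded_measurable3 (phase_space R) u ->
    bounded_measurable3 (phase_space R) v ->
    bounded_measurable3 (phase_space R) w ->
    bounded_measurable (phase_space R) (fun s => rotation_derivative
      (dot3 P (comb3 1 (u s) 1 (v s))) (c + dot3 Q (comb3 1 (u s) 1 (v s)))
      (k' * dot3 (u s) (v s)) P Q (comb3 a' (u s) c' (v s)) p q (w s)).
  move=> bu bv bw; apply: bounded_measurable_rotation_derivative => //.
  - apply: bounded_measurable_dot3; first exact: bounded_measurable3_cst.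
    exact: bounded_measurable3_comb3.
  - apply: bounded_measurableD; first exact: bounded_measurable_cst.
    apply: bounded_measurable_dot3; first exact: bounded_measurable3_cst.
    exact: bounded_measurable3_comb3.
  - apply: bounded_measurableM; first exact: bounded_measurable_cst.
    exact: bounded_measurable_dot3.
  - exact: bounded_measurable3_comb3.
have bG1 : bounded_measurable (phase_space R) G1 by exact: bG.
have bG2 : bounded_measurable (phase_space R) G2.
  rewrite (_ : G2 = fun s => rotation_derivative
    (dot3 P (comb3 1 s.1.1 1 s.2)) (c + dot3 Q (comb3 1 s.1.1 1 s.2))
    (- (b * J2) * dot3 s.1.1 s.2) P Q
    (comb3 (- (b * J3)) s.1.1 (- (b * J1)) s.2) p q s.1.2); first exact: bG.
  apply/funext => s; congr rotation_derivative; congr (_ * _).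
  by rewrite /dot3; ring.
have bG3 : bounded_measurable (phase_space R) G3 by exact: bG.
transitivity (phase_integral (fun s => G1 s + (G2 s + G3 s))).
  apply: eq_phase_integral => -[[[[x1 y1] z1] [[x2 y2] z2]] [[x3 y3] z3]] _.
  rewrite /G1 /G2 /G3 /rotation_derivative.
  set H := - b * hamiltonian J1 J2 J3 _.
  set e1 := (X in _ = _ * expR X + _).
  set e2 := (X in _ = _ + (_ * expR X + _)).
  set e3 := (X in _ = _ + (_ + _ * expR X)).
  have -> : e1 = H by rewrite /e1 /H /hamiltonian /dot3 /comb3/=; ring.
  have -> : e2 = H by rewrite /e2 /H /hamiltonian /dot3 /comb3/=; ring.
  have -> : e3 = H by rewrite /e3 /H /hamiltonian /dot3 /comb3/=; ring.
  (* In the remaining polynomial identity the derivatives of the exponents cancel in pairs, because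
     [rotation_field] is antisymmetric with respect to [dot3]. *)
  rewrite -!mulrDl; congr (_ * _).
  rewrite {e1 e2 e3 H} /= /total_spin /rotation_field /dot3 /comb3/=.
  rewrite {bG1 bG2 bG3 G1 G2 G3 bG}.
  ring.
rewrite (phase_integralD bG1 (bounded_measurableD bG2 bG3)).
rewrite (phase_integralD bG2 bG3).
rewrite (integral_phase_space0_site1 bG1); last first.
  move=> s2 s3 _ _; exact: (integral_rotation_derivative
    (dot3 P (comb3 1 s2 1 s3)) (c + dot3 Q (comb3 1 s2 1 s3))
    (- (b * J1) * dot3 s2 s3) P Q (comb3 (- (b * J3)) s2 (- (b * J2)) s3) p q).
rewrite (integral_phase_space0_site2 bG2); last first.
  move=> s1 s3 _ _; exact: (integral_rotation_derivative
    (dot3 P (comb3 1 s1 1 s3)) (c + dot3 Q (comb3 1 s1 1 s3))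
    (- (b * J2) * dot3 s3 s1) P Q (comb3 (- (b * J3)) s1 (- (b * J1)) s3) p q).
rewrite (integral_phase_space0_site3 bG3); last first.
  move=> s1 s2 _ _; exact: (integral_rotation_derivative
    (dot3 P (comb3 1 s1 1 s2)) (c + dot3 Q (comb3 1 s1 1 s2))
    (- (b * J3) * dot3 s1 s2) P Q (comb3 (- (b * J2)) s1 (- (b * J1)) s2) p q).
by rewrite !addr0.
Qed.

End rotation_invariance.

(** * Positive volume around prescribed configurations *)

Section positive_volume.
Context {R : realType}.

Definition box3 (e : R) (t : vec3 R) : set (vec3 R) :=
  [set s | [/\ `|s.1.1 - t.1.1| < e, `|s.1.2 - t.1.2| < e & `|s.2 - t.2| < e]].

Lemma measurable_box3 e t : measurable (box3 e t).
Proof.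
have -> : box3 e t = (ball t.1.1 e `*` ball t.1.2 e) `*` ball t.2 e.
  apply/seteqP; split => [[[a b] c]|[[a b] c]] /=.
    by case=> ? ? ?; split; [split|]; rewrite /ball/= distrC.
  by case=> -[+ + +]; rewrite /ball/= => ? ? ?; split; rewrite distrC.
by apply: measurableX; [apply: measurableX|]; exact: measurable_ball.
Qed.

Lemma measurable_sphere_box3 e t : measurable (sphere2 R `&` box3 e t).
Proof. by apply: measurableI; [exact: measurable_sphere2|exact: measurable_box3]. Qed.

(** By continuity a small closed rectangle of angles around [u] is mapped into the box. Since [u] is
    interior to the chart, the rectangle can be kept inside it, with the area element above half its
    value at [u]. *)
Lemma surface_measure_box3_gt0 (e : R) (u : vec2 R) : 0 < e ->
  0 < u.1 < pi -> 0 < u.2 < pi *+ 2 ->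
  (0 < surface_measure (sphere2 R `&` box3 e (sphere_param u)))%E.
Proof.
case: u => t f /= e0 /andP[t0 tpi] /andP[f0 fpi].
have st : 0 < sin t by rewrite sin_gt0_pi// t0.
have e2 : 0 < e / 2 by rewrite divr_gt0.
have cs := @continuous_sin R; have cc := @continuous_cos R.
have sn x := @sin_geN1 R x; have s1 x := @sin_le1 R x.
have cn x := @cos_geN1 R x; have c1 x := @cos_le1 R x.
have : \forall x \near t, [/\ `|sin t - sin x| < e / 2, `|cos t - cos x| < e / 2,
    0 < x < pi & sin t / 2 < sin x].
  near=> x; split.
  - by near: x; move/cvgrPdist_lt : (cs t); apply.
  - by near: x; move/cvgrPdist_lt : (cc t); apply.
  - by near: x; apply: near_in_itvoo; rewrite in_itv/= t0.
  - near: x; apply: (cvgr_gt _ (cs t)).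
    by rewrite ltr_pdivrMr// mulr_natr mulr2n ltrDl.
move=> /nbhs_ballP[r /= r0 tr].
have : \forall x \near f, [/\ `|sin f - sin x| < e / 2, `|cos f - cos x| < e / 2 &
    0 < x < pi *+ 2].
  near=> x; split.
  - by near: x; move/cvgrPdist_lt : (cs f); apply.
  - by near: x; move/cvgrPdist_lt : (cc f); apply.
  - by near: x; apply: near_in_itvoo; rewrite in_itv/= f0.
move=> /nbhs_ballP[r' /= r'0 fr].
pose I := `[t - r / 2, t + r / 2]%classic.
pose I' := `[f - r' / 2, f + r' / 2]%classic.
have It x : I x -> [/\ `|sin t - sin x| < e / 2, `|cos t - cos x| < e / 2,
    0 < x < pi & sin t / 2 < sin x].
  rewrite /I/= in_itv/= => xt; apply: tr; rewrite /ball/= ltr_norml; lra.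
have If x : I' x -> [/\ `|sin f - sin x| < e / 2, `|cos f - cos x| < e / 2 &
    0 < x < pi *+ 2].
  rewrite /I'/= in_itv/= => xf; apply: fr; rewrite /ball/= ltr_norml; lra.
have sub : I `*` I' `<=`
    sphere_chart R `&` sphere_param @^-1` (sphere2 R `&` box3 e (sphere_param (t, f))).
  move=> [x y] [/= /It[a1 a2 /andP[a3 a3'] a4] /If[b1 b2 /andP[b3 b3']]].
  split; [|split].
  - by split => /=; rewrite in_itv/= ?(ltW a3) ?(ltW a3') ?(ltW b3) ?(ltW b3').
  - exact: dot3_sphere_param.
  - have near_mul (a b a' b' : R) : `|a'| <= 1 -> `|b| <= 1 -> `|a - a'| < e / 2 ->
        `|b - b'| < e / 2 -> `|a' * b' - a * b| < e.
      move=> la lb ha hb; rewrite distrC.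
      have -> : a * b - a' * b' = (a - a') * b + a' * (b - b') by ring.
      rewrite (le_lt_trans (ler_normD _ _))// !normrM [e]splitr ltr_leD//.
        by rewrite (le_lt_trans _ ha)// -[leRHS]mulr1 ler_wpM2l.
      by rewrite (le_trans _ (ltW hb))// -[leRHS]mul1r ler_wpM2r.
    have sle z : `|sin z : R| <= 1 by rewrite ler_norml sn s1.
    have cle z : `|cos z : R| <= 1 by rewrite ler_norml cn c1.
    split => /=; [exact: near_mul|exact: near_mul|].
    by rewrite distrC (lt_trans a2)// ltr_pdivrMr// mulr_natr mulr2n ltrDl.
have mI : measurable (I `*` I') by apply: measurableX; exact: measurable_itv.
rewrite /surface_measure.
apply: (@lt_le_trans _ _ (\int[lebesgue_measure \x lebesgue_measure]_(u in I `*` I')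
    (sin t / 2)%:E)%E).
  rewrite integral_cst//.
  rewrite [X in (_ * X)%E](_ : _ = (lebesgue_measure I * lebesgue_measure I')%E);
    last by apply: product_measure1E; exact: measurable_itv.
  rewrite /= !lebesgue_measure_itv/= !lte_fin !ifT; [|lra..].
  by rewrite -!EFinD -!EFinM lte_fin !mulr_gt0 ?invr_gt0//; lra.
apply: (@le_trans _ _ (\int[lebesgue_measure \x lebesgue_measure]_(u in I `*` I')
    (sin u.1)%:E)%E).
  apply: ge0_le_integral => //.
  - by move=> u _; rewrite lee_fin divr_ge0// ltW.
  - exact: measurable_funTS measurable_sphere_element.
  - by move=> u [/It[_ _ _ /ltW]].
apply: ge0_subset_integral => //.
- apply: measurableI; first exact: measurable_sphere_chart.
  rewrite -[X in measurable X]setTI; apply: measurable_sphere_param => //.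
  exact: measurable_sphere_box3.
- exact: measurable_funTS measurable_sphere_element.
- by move=> u [uc _]; rewrite lee_fin sphere_element_ge0.
Unshelve. all: by end_near. Qed.

Lemma phase_volume_box3_gt0 (e : R) (u1 u2 u3 : vec2 R) : 0 < e ->
  (forall u, List.In u [:: u1; u2; u3] -> 0 < u.1 < pi /\ 0 < u.2 < pi *+ 2) ->
  (0 < phase_volume R
    ((sphere2 R `&` box3 e (sphere_param u1))
     `*` (sphere2 R `&` box3 e (sphere_param u2))
     `*` (sphere2 R `&` box3 e (sphere_param u3))))%E.
Proof.
move=> e0 u123.
have mb (u : vec2 R) := measurable_sphere_box3 e (sphere_param u).
have E3 (A B C : set (vec3 R)) : measurable A -> measurable B -> measurable C ->
    phase_volume R (A `*` B `*` C) =
    (surface_measure A * surface_measure B * surface_measure C)%E.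
  move=> mA mB mC; transitivity (surface_measure2 R (A `*` B) * surface_measure C)%E.
    by apply: product_measure1E => //; exact: measurableX.
  by congr (_ * _)%E; exact: product_measure1E.
have box_gt0 u : List.In u [:: u1; u2; u3] ->
    (0 < surface_measure (sphere2 R `&` box3 e (sphere_param u)))%E.
  by move=> /u123[? ?]; exact: surface_measure_box3_gt0.
by rewrite E3//; do 2 ?apply: mule_gt0; apply: box_gt0 => /=; tauto.
Qed.

End positive_volume.

(** * Differentiation and concentration of Gibbs integrals *)

Section gibbs_integrals.
Context {R : realType}.
Implicit Types f g h k : spins R -> R.
Local Notation bm := (bounded_measurable (phase_space R)).

Lemma is_derive_expR_affine (a b c x : R) :
  is_derive x 1 (fun y => a * expR (b + y * c)) (a * c * expR (b + x * c)).
Proof.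
pose u : R -> R := cst b + c *: id.
have du : is_derive x 1 u c.
  have d1 : is_derive x 1 (c *: id : R -> R) (c *: (1 : R)).
    by apply: is_deriveZ; exact: is_derive_id.
  have : is_derive x 1 u (0 + c *: (1 : R)).
    by apply: is_deriveD => //; exact: is_derive_cst.
  by rewrite /GRing.scale/= mulr1 add0r.
have uE y : u y = b + y * c.
  by rewrite /u !fctE /GRing.scale/= [c * y]mulrC.
have -> : (fun y => a * expR (b + y * c)) = a *: (expR \o u).
  by apply/funext => y; rewrite /= !fctE uE.
have de : is_derive x 1 (expR \o u) (expR (u x) * c).
  exact: is_derive1_comp.
apply: is_derive_eq.
by rewrite uE /GRing.scale/=; ring.
Qed.

(** For [x] in the interval from -1 to 1 the derivative of the integrand is dominated by a constant.
    The parameter [x] stands for the magnetic field in the susceptibility formula and for the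
    inverse temperature in the high temperature limit. *)
Lemma is_derive_phase_integral g h k : bm g -> bm h -> bm k ->
  is_derive (0 : R) 1
    (fun x => phase_integral (fun s => g s * expR (h s + x * k s)))
    (phase_integral (fun s => g s * k s * expR (h s))).
Proof.
move=> bg bh bk; pose f (x : R) (s : spins R) := g s * expR (h s + x * k s).
have bf (x : R) : bm (f x).
  apply: bounded_measurableM => //; apply: bounded_measurable_expR.
  apply: bounded_measurableD => //; apply: bounded_measurableM => //.
  exact: bounded_measurable_cst.
have intf (x : R) : `]-1, 1[%classic x ->
    (phase_volume R).-integrable (phase_space R) (EFin \o f x).
  by move=> _; exact: integrable_phase_space.
have df (x : R) (s : spins R) : is_derive x 1 (f ^~ s) (g s * k s * expR (h s + x * k s)).
  exact: is_derive_expR_affine.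
have dfE (x : R) (s : spins R) : partial1of2 f x s = g s * k s * expR (h s + x * k s).
  by rewrite partial1of2E; exact: derive_val.
have [_ [Mg gM]] := bg; have [_ [Mh hM]] := bh; have [_ [Mk kM]] := bk.
pose M := `|Mg| * `|Mk| * expR (Mh + Mk).
have M0 : 0 <= M by rewrite !mulr_ge0 ?expR_ge0.
have intM : (phase_volume R).-integrable (phase_space R)
    (EFin \o (fun _ : spins R => M)).
  by apply: integrable_phase_space; exact: bounded_measurable_cst.
have fM (x : R) (s : spins R) : `]-1, 1[%classic x -> phase_space R s ->
    `|partial1of2 f x s| <= M.
  rewrite /= in_itv/= => /andP[x1 x2] Ps; rewrite dfE !normrM.
  rewrite (ger0_norm (expR_ge0 _)) !ler_pM ?mulr_ge0 ?expR_ge0//.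
  - by rewrite (le_trans (gM _ Ps))// ler_norm.
  - by rewrite (le_trans (kM _ Ps))// ler_norm.
  - rewrite ler_expR lerD// ?(le_trans (ler_norm _) (hM _ Ps))//.
    rewrite (le_trans (ler_norm _))// normrM -[leRHS]mul1r ler_pM//.
      by rewrite ler_norml !ltW.
    exact: kM.
have I0 : `]-1, 1[%classic (0 : R) by rewrite /= in_itv/= ltrN10 ltr01.
have dx (x : R) (s : spins R) : `]-1, 1[%classic x -> phase_space R s -> derivable (f ^~ s) x 1.
  by move=> _ _; exact: ex_derive.
have mP := @measurable_phase_space R.
apply: DeriveDef.
  exact: (derivable_under_integral mP I0 intf dx (fun=> M0) intM fM).
rewrite -derive1E.
rewrite [LHS](differentiation_under_integral mP I0 intf dx (fun=> M0) intM fM).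
by apply: eq_phase_integral => s _; rewrite dfE mul0r addr0.
Qed.

(** Markov's inequality, by comparison with [c * \1_A]; it bounds partition functions from below. *)
Lemma phase_integral_ge (A : set (spins R)) (c : R) f : measurable A ->
  A `<=` phase_space R -> bm f -> (forall s, phase_space R s -> 0 <= f s) ->
  (forall s, A s -> c <= f s) ->
  c * fine (phase_volume R A) <= phase_integral f.
Proof.
move=> mA AP bf f0 cf.
have bA : bm (\1_A : spins R -> R).
  split; first exact: measurable_indic.
  by exists 1 => s _; rewrite indicE; case: (_ \in _); rewrite ?normr1 ?normr0.
apply: (@le_trans _ _ (phase_integral (fun s => c * \1_A s))).
  have AE : (\int[phase_volume R]_(s in phase_space R) (\1_A s)%:E =
      phase_volume R A)%E.
    rewrite integral_indic; [|exact: measurable_phase_space|exact: mA].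
    by rewrite setIidl.
  rewrite (phase_integralZ c bA) /phase_integral /Rintegral AE.
  exact: lexx.
apply: le_phase_integral => //.
  by apply: bounded_measurableM => //; exact: bounded_measurable_cst.
move=> s Ps; rewrite indicE; case: (boolP (s \in A)) => [/set_mem As|_].
  by rewrite mulr1 cf.
by rewrite mulr0 f0.
Qed.

(** Laplace's method. Where [h - h0 <= d] the closeness hypothesis controls [g - g0]; elsewhere the
    weight is at most [expR (- b * (h0 + d))]. The partition function is at least a positive
    constant times [expR (- b * (h0 + d / 2))], so the second contribution is exponentially small
    relative to it. *)
Lemma laplace_phase_integral (g h : spins R -> R) (g0 h0 : R) : bm g -> bm h ->
  (forall s, phase_space R s -> h0 <= h s) ->
  (forall d : R, 0 < d -> exists A : set (spins R), [/\ measurable A, A `<=` phase_space R,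
     (0 < phase_volume R A)%E & forall s, A s -> h s <= h0 + d]) ->
  (forall e : R, 0 < e -> exists C : R, forall s, phase_space R s ->
     `|g s - g0| <= e + C * (h s - h0)) ->
  phase_integral (fun s => g s * expR (- b * h s)) /
    phase_integral (fun s => expR (- b * h s)) @[b --> +oo] --> g0.
Proof.
move=> bg bh h0h small close; apply/cvgrPdist_le => e e0.
have e4 : 0 < e / 4 by rewrite divr_gt0.
have [C0 gC0] := close _ e4.
(* [C0] may have any sign; enlarging it to a positive constant keeps the bound because [h - h0] is
   nonnegative on the phase space. *)
pose C := `|C0| + 1.
have C1 : 0 < C by rewrite ltr_wpDl.
have gC (s : spins R) : phase_space R s -> `|g s - g0| <= e / 4 + C * (h s - h0).
  move=> Ps; rewrite (le_trans (gC0 _ Ps))// lerD2l ler_wpM2r ?subr_ge0 ?h0h//.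
  by rewrite (le_trans (ler_norm _))// lerDl.
pose d := e / 4 / C.
have d0 : 0 < d by rewrite divr_gt0.
have d2 : 0 < d / 2 by rewrite divr_gt0.
have [A [mA AP A0 Ah]] := small _ d2.
pose m := fine (phase_volume R A).
have m0 : 0 < m by rewrite fine_gt0// A0 phase_volume_lty.
have [_ [Mh hM]] := bh.
pose M := `|Mh| + `|h0|.
have M0 : 0 <= M by rewrite addr_ge0.
have hM' (s : spins R) : phase_space R s -> h s - h0 <= M.
  move=> Ps; rewrite (le_trans (ler_norm _))// (le_trans (ler_normB _ _))// lerD//.
  by rewrite (le_trans (hM _ Ps))// ler_norm.
pose V : R := phase_integral (fun _ : spins R => 1).
have V0 : 0 <= V by apply: Rintegral_ge0.
have bc (r : R) := @bounded_measurable_cst _ (spins R) R (phase_space R) r.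
near=> b.
have b0 : 0 < b by near: b; exact: nbhs_pinfty_gt.
pose w (s : spins R) := expR (- b * h s).
have bw : bm w by apply: bounded_measurable_expR; exact: bounded_measurableM.
pose Z := phase_integral w.
have Zm : expR (- b * (h0 + d / 2)) * m <= Z.
  apply: phase_integral_ge => // s; first by rewrite expR_ge0.
  by move=> /Ah hs; rewrite /w ler_expR !mulNr lerN2 ler_wpM2l// ltW.
have Z0 : 0 < Z by rewrite (lt_le_trans _ Zm)// mulr_gt0 ?expR_gt0.
have bgw : bm (fun s => (g s - g0) * w s).
  by apply: bounded_measurableM => //; exact: bounded_measurableB.
pose B := (e / 4 + C * d) * Z + C * M * expR (- b * (h0 + d)) * V.
have bB : bm (fun s => (e / 4 + C * d) * w s + C * M * expR (- b * (h0 + d)) * 1).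
  by apply: bounded_measurableD; exact: bounded_measurableM.
have BE : phase_integral
    (fun s => (e / 4 + C * d) * w s + C * M * expR (- b * (h0 + d)) * 1) = B.
  by rewrite phase_integralD ?phase_integralZ//; exact: bounded_measurableM.
have ptw (s : spins R) : phase_space R s ->
    `|g s - g0| * w s <= (e / 4 + C * d) * w s + C * M * expR (- b * (h0 + d)) * 1.
  move=> Ps; rewrite mulr1 (le_trans (ler_wpM2r (expR_ge0 _) (gC _ Ps)))//.
  suff hw : (h s - h0) * w s <= d * w s + M * expR (- b * (h0 + d)).
    by move/(ler_wpM2l (ltW C1)) : hw; rewrite -/(w s); lra.
  have [hd|hd] := leP (h s - h0) d.
    by rewrite ler_wpDr ?mulr_ge0 ?expR_ge0// ler_wpM2r ?expR_ge0.
  have wX : w s <= expR (- b * (h0 + d)).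
    rewrite /w ler_expR !mulNr lerN2 ler_wpM2l ?(ltW b0)//.
    by move: hd; lra.
  have dw : 0 <= d * w s by rewrite mulr_ge0 ?expR_ge0// ltW.
  have : (h s - h0) * w s <= M * expR (- b * (h0 + d)).
    by apply: ler_pM; rewrite ?expR_ge0 ?subr_ge0 ?h0h ?hM'.
  by move: dw; lra.
have up : phase_integral (fun s => (g s - g0) * w s) <= B.
  rewrite -BE; apply: le_phase_integral => // s Ps.
  by rewrite (le_trans _ (ptw s Ps))// ler_wpM2r ?expR_ge0// ler_norm.
have lo : - B <= phase_integral (fun s => (g s - g0) * w s).
  rewrite -BE -[leLHS]mulN1r -phase_integralZ//; apply: le_phase_integral => //.
    exact: bounded_measurableM.
  move=> s Ps; rewrite mulN1r lerNl -mulNr (le_trans _ (ptw s Ps))//.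
  by rewrite ler_wpM2r ?expR_ge0// -normrN ler_norm.
have gE : phase_integral (fun s => (g s - g0) * w s) =
    phase_integral (fun s => g s * w s) - g0 * Z.
  rewrite -mulNr -phase_integralZ// -phase_integralD//;
    [|exact: bounded_measurableM..].
  by apply: eq_phase_integral => s _; rewrite mulrBl mulNr.
have small_tail : C * M * V / m * expR (- (b * (d / 2))) <= e / 4.
  near: b.
  have : C * M * V / m * expR (- (b * (d / 2))) @[b --> +oo] --> (0 : R).
    rewrite -[X in _ --> X](mulr0 (C * M * V / m)).
    apply: cvgM; first exact: cvg_cst.
    apply: (cvg_comp _ _ _ (@cvgr_expR R)).
    exact: gt0_cvgMly.
  move/cvgrPdist_le => /(_ _ e4); apply: filterS => x /=.
  by rewrite sub0r normrN; apply: le_trans; rewrite ler_norm.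
(* The bound consists of [e / 4] from the closeness hypothesis, [C * d = e / 4] from the region near
   the minimum, and at most [e / 4] from the tail, all relative to [Z]. *)
have BZ : B <= e * Z.
  have eE : expR (- b * (h0 + d)) =
      expR (- (b * (d / 2))) * expR (- b * (h0 + d / 2)).
    by rewrite -expRD; congr expR; lra.
  have Cd : C * d = e / 4 by rewrite /d mulrC divfK// gt_eqF.
  set X := expR (- (b * (d / 2))) in small_tail eE.
  set Y := expR (- b * (h0 + d / 2)) in eE Zm.
  have Y0 : 0 <= Y by exact: expR_ge0.
  have tail : C * M * V * X <= e / 4 * m.
    by move: small_tail; rewrite mulrAC ler_pdivrMr.
  have tailY : C * M * V * X * Y <= e / 4 * Z.
    apply: (le_trans (ler_wpM2r Y0 tail)).
    by rewrite -(mulrA (e / 4)) (mulrC m); apply: ler_wpM2l => //; exact: ltW.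
  have eZ : 0 <= e / 4 * Z by rewrite mulr_ge0 ?ltW.
  by rewrite /B Cd eE; lra.
have -> : g0 - phase_integral (fun s => g s * w s) / Z =
    - phase_integral (fun s => (g s - g0) * w s) / Z.
  by rewrite gE; field; rewrite gt_eqF.
rewrite normrM normrN normfV (gtr0_norm Z0) ler_pdivrMr// (le_trans _ BZ)//.
by rewrite ler_norml lo up.
Unshelve. all: by end_near. Qed.

End gibbs_integrals.

(** * Susceptibility as a mean square spin *)

Section susceptibility.
Context {R : realType}.
Implicit Types (b T : R) (s : spins R) (f : spins R -> R).
Local Notation bm := (bounded_measurable (phase_space R)).
Local Notation bm3 := (bounded_measurable3 (phase_space R)).
Local Notation bmc := (@bounded_measurable_cst _ (spins R) R (phase_space R)).

Definition total_spin_sq s : R := dot3 (total_spin s) (total_spin s).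

Lemma total_spin3E s : total_spin3 s = (total_spin s).2.
Proof. by rewrite /total_spin3 /total_spin /comb3/= !mul1r. Qed.

Lemma bounded_measurable3_total_spin : bm3 total_spin.
Proof.
apply: bounded_measurable3_comb3; last exact: bounded_measurable3_site3.
apply: bounded_measurable3_comb3; first exact: bounded_measurable3_site1.
exact: bounded_measurable3_site2.
Qed.

Lemma bounded_measurable_total_spin3 : bm total_spin3.
Proof.
have -> : total_spin3 = fun s => (total_spin s).2.
  by apply/funext => s; exact: total_spin3E.
by have [] := bounded_measurable3_total_spin.
Qed.

Lemma bounded_measurable_total_spin_sq : bm total_spin_sq.
Proof.
by apply: bounded_measurable_dot3; exact: bounded_measurable3_total_spin.
Qed.

Lemma bounded_measurable_hamiltonian J1 J2 J3 : bm (hamiltonian J1 J2 J3).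
Proof.
have b1 := @bounded_measurable3_site1 R.
have b2 := @bounded_measurable3_site2 R.
have b3 := @bounded_measurable3_site3 R.
apply: bounded_measurableD; last first.
  apply: bounded_measurableM; first exact: bmc.
  exact: bounded_measurable_dot3.
by apply: bounded_measurableD; apply: bounded_measurableM;
  [exact: bmc|exact: bounded_measurable_dot3|exact: bmc|exact: bounded_measurable_dot3].
Qed.

Lemma bounded_measurable_boltzmann J1 J2 J3 b :
  bm (fun s => expR (- b * hamiltonian J1 J2 J3 s)).
Proof.
apply: bounded_measurable_expR; apply: bounded_measurableM; first exact: bmc.
exact: bounded_measurable_hamiltonian.
Qed.

Lemma phase_integral_gt0 f : bm f ->
  (exists2 c, 0 < c & forall s, phase_space R s -> c <= f s) ->
  0 < phase_integral f.
Proof.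
move=> bf [c c0 cf].
(* An arbitrary interior point of the chart; the box around it shows that the phase space has
   positive volume. *)
pose u : vec2 R := (pi / 2, pi / 2).
have pi0 := pi_gt0 R.
have uP : 0 < u.1 < pi /\ 0 < u.2 < pi *+ 2.
  have h1 : 0 < (pi : R) / 2 by rewrite divr_gt0.
  have h2 : (pi : R) / 2 < pi by rewrite ltr_pdivrMr// mulr_natr mulr2n ltrDl.
  have h3 : (pi : R) / 2 < pi *+ 2 by rewrite (lt_trans h2)// mulr2n ltrDl.
  by split; apply/andP; split.
have V0 : (0 < phase_volume R (phase_space R))%E.
  apply: (lt_le_trans (phase_volume_box3_gt0 (u1 := u) (u2 := u) (u3 := u)
    ltr01 _)).
    by move=> v /= [<-|[<-|[<-|//]]].
  apply: le_measure; rewrite ?inE.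
  - by apply: measurableX; [apply: measurableX|]; exact: measurable_sphere_box3.
  - exact: measurable_phase_space.
  - by move=> [[s1 s2] s3] /= [[[? _] [? _]] [? _]].
apply: (@lt_le_trans _ _ (c * fine (phase_volume R (phase_space R)))).
  rewrite mulr_gt0// fine_gt0// V0 phase_volume_lty//.
  exact: measurable_phase_space.
apply: phase_integral_ge => //; first exact: measurable_phase_space.
by move=> s Ps; rewrite (le_trans (ltW c0))// cf.
Qed.

Lemma partition_function_gt0 J1 J2 J3 b :
  0 < phase_integral (fun s => expR (- b * hamiltonian J1 J2 J3 s)).
Proof.
apply: phase_integral_gt0; first exact: bounded_measurable_boltzmann.
have [_ [M hM]] := bounded_measurableM (bmc (- b))
  (bounded_measurable_hamiltonian J1 J2 J3).
exists (expR (- M)) => [|s Ps]; first exact: expR_gt0.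
by rewrite ler_expR lerNl (le_trans (ler_norm _))// normrN hM.
Qed.

Lemma phase_integral_total_spin3 J1 J2 J3 b :
  phase_integral (fun s =>
    total_spin3 s * expR (- b * hamiltonian J1 J2 J3 s)) = 0.
Proof.
(* With [c = 1], [Q = 0] and [P] the first basis vector, the rotated observable is the first
   component of the total spin, whose derivative is the third. *)
rewrite -(integral_rotated_observable J1 J2 J3 b 1 (1, 0, 0) (0, 0, 0) 1 0).
apply: eq_phase_integral => s _; congr (_ * _).
by rewrite total_spin3E /rotation_field /dot3 /=; ring.
Qed.

Lemma phase_integral_total_spin3_sq J1 J2 J3 b :
  phase_integral (fun s =>
    total_spin3 s ^+ 2 * expR (- b * hamiltonian J1 J2 J3 s)) =
  3^-1 * phase_integral (fun s =>
    total_spin_sq s * expR (- b * hamiltonian J1 J2 J3 s)).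
Proof.
pose w s := expR (- b * hamiltonian J1 J2 J3 s).
have bw : bm w by exact: bounded_measurable_boltzmann.
have [bx by_ bz] := bounded_measurable3_total_spin.
pose X s := (total_spin s).1.1 * (total_spin s).1.1 * w s.
pose Y s := (total_spin s).1.2 * (total_spin s).1.2 * w s.
pose Z s := (total_spin s).2 * (total_spin s).2 * w s.
have bX : bm X by do 2 apply: bounded_measurableM => //.
have bY : bm Y by do 2 apply: bounded_measurableM => //.
have bZ : bm Z by do 2 apply: bounded_measurableM => //.
have bN f : bm f -> bm (fun s => -1 * f s).
  by move=> bf; apply: bounded_measurableM => //; exact: bmc.
have ZX : phase_integral Z = phase_integral X.
  apply/eqP; rewrite -subr_eq0 -mulN1r -phase_integralZ//; apply/eqP.
  rewrite -phase_integralD//; last exact: bN.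
  (* The derivative of the product of the first and third components is the difference of their
     squares. *)
  rewrite -(integral_rotated_observable J1 J2 J3 b 0 (1, 0, 0) (0, 0, 1) 1 0).
  apply: eq_phase_integral => s _; rewrite /Z /X mulrA -mulrDl; congr (_ * _).
  by rewrite /rotation_field /dot3 /=; ring.
have ZY : phase_integral Z = phase_integral Y.
  apply/eqP; rewrite -subr_eq0 -mulN1r -phase_integralZ//; apply/eqP.
  rewrite -phase_integralD//; last exact: bN.
  rewrite -(integral_rotated_observable J1 J2 J3 b 0 (0, 1, 0) (0, 0, 1) 0 1).
  apply: eq_phase_integral => s _; rewrite /Z /Y mulrA -mulrDl; congr (_ * _).
  by rewrite /rotation_field /dot3 /=; ring.
transitivity (phase_integral Z).
  by apply: eq_phase_integral => s _; rewrite total_spin3E expr2.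
transitivity (3^-1 * phase_integral (fun s => X s + (Y s + Z s))).
  rewrite (phase_integralD bX (bounded_measurableD bY bZ)).
  by rewrite (phase_integralD bY bZ) -ZX -ZY; field.
congr (_ * _); apply: eq_phase_integral => s _.
by rewrite /X /Y /Z -!mulrDl addrA.
Qed.

(* The quotient rule would also produce the squared mean of the spin, which
   vanishes by rotation invariance. *)
Lemma temperature_susceptibility J1 J2 J3 T : T != 0 ->
  T * susceptibility J1 J2 J3 T =
  3^-1 * (phase_integral (fun s =>
            total_spin_sq s * expR (- (T^-1) * hamiltonian J1 J2 J3 s)) /
          phase_integral (fun s => expR (- (T^-1) * hamiltonian J1 J2 J3 s))).
Proof.
move=> T0; set b := T^-1.
pose h s := - b * hamiltonian J1 J2 J3 s.
pose k s := b * total_spin3 s.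
have bh : bm h.
  by apply: bounded_measurableM; [exact: bmc|exact: bounded_measurable_hamiltonian].
have bk : bm k.
  by apply: bounded_measurableM; [exact: bmc|exact: bounded_measurable_total_spin3].
have bS := bounded_measurable_total_spin3.
pose N (B : R) := phase_integral (fun s => total_spin3 s * expR (h s + B * k s)).
(* The exponent is affine in the field [B]. The factor [1] gives the denominator the same shape as
   the numerator, so one differentiation lemma serves both. *)
pose Z (B : R) := phase_integral (fun s => 1 * expR (h s + B * k s)).
have magE : magnetization J1 J2 J3 T = fun B => N B / Z B.
  apply/funext => B; rewrite /magnetization div1r -/b; congr (_ / _).
    apply: eq_phase_integral => s _; congr (_ * expR _).
    by rewrite /h /k /field_hamiltonian; ring.
  apply: eq_phase_integral => s _; rewrite mul1r; congr expR.
  by rewrite /h /k /field_hamiltonian; ring.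
have dN := is_derive_phase_integral bS bh bk.
have dZ := is_derive_phase_integral (bmc 1) bh bk.
have Z0E : Z 0 = phase_integral (fun s => expR (h s)).
  by apply: eq_phase_integral => s _; rewrite mul1r mul0r addr0.
have Z0 : Z 0 != 0 by rewrite Z0E gt_eqF// partition_function_gt0.
have N0 : N 0 = 0.
  rewrite -[RHS](phase_integral_total_spin3 J1 J2 J3 b).
  by apply: eq_phase_integral => s _; rewrite mul0r addr0.
have dM : is_derive (0 : R) 1 (fun B => N B / Z B)
  (N 0 *: (- Z 0 ^- 2 *: phase_integral (fun s => 1 * k s * expR (h s)))
   + (Z 0)^-1 *: phase_integral (fun s => total_spin3 s * k s * expR (h s))).
  exact: is_deriveM dN (is_deriveV Z0 dZ).
rewrite /susceptibility magE derive1E [X in T * X](@derive_val _ _ _ _ _ _ _ dM).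
rewrite N0 scale0r add0r.
have -> : phase_integral (fun s => total_spin3 s * k s * expR (h s)) =
    b * phase_integral (fun s => total_spin3 s ^+ 2 * expR (h s)).
  rewrite -phase_integralZ; last first.
    by apply: bounded_measurableM; [exact: bounded_measurableX|exact: bounded_measurable_expR].
  by apply: eq_phase_integral => s _; rewrite /k; ring.
rewrite (phase_integral_total_spin3_sq J1 J2 J3 b) /GRing.scale/= -Z0E.
by rewrite mulrCA /b; field; rewrite Z0.
Qed.

End susceptibility.

(** * High and low temperature limits *)

Section temperature_limits.
Context {R : realType}.
Implicit Types (b T : R) (s : spins R) (f : spins R -> R).
Local Notation bm := (bounded_measurable (phase_space R)).
Local Notation bmc := (@bounded_measurable_cst _ (spins R) R (phase_space R)).

(** Every linear function is a sum of two rotation derivatives: rotating minus the third coordinate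
    yields the part in the first two coordinates, and rotating [v.2] times the first coordinate
    yields the rest. *)
Lemma integral_sphere_dot3 (v : vec3 R) :
  (\int[surface_measure]_(s in sphere2 R) (dot3 v s)%:E = 0)%E.
Proof.
pose z : vec3 R := (0, 0, 0).
pose f1 := rotation_derivative 0 1 0 (0, 0, -1) z z v.1.1 v.1.2.
pose f2 := rotation_derivative 0 1 0 (v.2, 0, 0) z z 1 0.
have bf a c r P Q k p q : bounded_measurable (sphere2 R)
    (rotation_derivative a c r P Q k p q).
  apply: bounded_measurable_rotation_derivative;
    [exact: bounded_measurable_cst..| |].
    exact: bounded_measurable3_cst.
  exact: bounded_measurable3_sphere.
have intf g : bounded_measurable (sphere2 R) g ->
    surface_measure.-integrable (sphere2 R) (EFin \o g).
  apply: bounded_measurable_integrable; first exact: measurable_sphere2.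
  rewrite -ge0_fin_numE//; apply: fin_num_measure; exact: measurable_sphere2.
have fE (s : vec3 R) : dot3 v s = f1 s + f2 s.
  rewrite /f1 /f2 /rotation_derivative.
  have -> : 0 + dot3 z s = 0 by rewrite /dot3 /z/=; ring.
  by rewrite expR0 /rotation_field /dot3 /z/=; ring.
under eq_integral do rewrite fE.
rewrite (integralD_EFin measurable_sphere2 (intf _ (bf _ _ _ _ _ _ _ _))
  (intf _ (bf _ _ _ _ _ _ _ _))).
by rewrite !integral_rotation_derivative adde0.
Qed.

Lemma phase_space_dot3 s : phase_space R s ->
  [/\ dot3 s.1.1 s.1.1 = 1, dot3 s.1.2 s.1.2 = 1 & dot3 s.2 s.2 = 1].
Proof. by move=> [[]]. Qed.

Lemma total_spin_sqE s : phase_space R s ->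
  total_spin_sq s =
  3 + 2 * (dot3 s.1.1 s.1.2 + dot3 s.2 s.1.1 + dot3 s.1.2 s.2).
Proof.
move=> /phase_space_dot3[e1 e2 e3].
transitivity (dot3 s.1.1 s.1.1 + dot3 s.1.2 s.1.2 + dot3 s.2 s.2
  + 2 * (dot3 s.1.1 s.1.2 + dot3 s.2 s.1.1 + dot3 s.1.2 s.2)).
  by rewrite /total_spin_sq /total_spin /comb3 /dot3/=; ring.
by rewrite e1 e2 e3; ring.
Qed.

Lemma phase_integral_total_spin_sq :
  phase_integral (fun s => total_spin_sq s) =
  3 * phase_integral (fun _ : spins R => 1).
Proof.
have b1 := @bounded_measurable3_site1 R.
have b2 := @bounded_measurable3_site2 R.
have b3 := @bounded_measurable3_site3 R.
(* The cross terms of the squared total spin, grouped by a spin in which they are linear: [f1]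
   integrates to zero over the first spin and [f2] over the second. *)
pose f1 s := dot3 (comb3 2 s.1.2 2 s.2) s.1.1.
pose f2 s := dot3 (comb3 2 s.2 0 s.2) s.1.2.
have bf1 : bm f1.
  by apply: bounded_measurable_dot3 => //; exact: bounded_measurable3_comb3.
have bf2 : bm f2.
  by apply: bounded_measurable_dot3 => //; exact: bounded_measurable3_comb3.
transitivity (phase_integral (fun s => 3 * 1 + (f1 s + f2 s))).
  apply: eq_phase_integral => s Ps; rewrite (total_spin_sqE Ps).
  by rewrite /f1 /f2 /comb3 /dot3/=; ring.
rewrite (phase_integralD (bmc (3 * 1)) (bounded_measurableD bf1 bf2)).
rewrite (phase_integralD bf1 bf2) (phase_integralZ _ (bmc 1)).
rewrite (integral_phase_space0_site1 bf1); last first.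
  by move=> s2 s3 _ _; exact: (integral_sphere_dot3 (comb3 2 s2 2 s3)).
rewrite (integral_phase_space0_site2 bf2); last first.
  by move=> s1 s3 _ _; exact: (integral_sphere_dot3 (comb3 2 s3 0 s3)).
by rewrite !addr0.
Qed.

Lemma high_temperature_susceptibility (J1 J2 J3 : R) :
  T * susceptibility J1 J2 J3 T @[T --> +oo] --> (1 : R).
Proof.
pose H s := hamiltonian J1 J2 J3 s.
(* Written as functions of the inverse temperature [b], numerator and denominator are differentiable
   at 0, hence continuous there. *)
pose N b := phase_integral (fun s => total_spin_sq s * expR (0 + b * - H s)).
pose Z b := phase_integral (fun s => 1 * expR (0 + b * - H s)).
have bH : bm (fun s => - H s).
  by apply: bounded_measurableN; exact: bounded_measurable_hamiltonian.
have dN : is_derive (0 : R) 1 N _ :=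
  is_derive_phase_integral bounded_measurable_total_spin_sq (bmc 0) bH.
have dZ : is_derive (0 : R) 1 Z _ := is_derive_phase_integral (bmc 1) (bmc 0) bH.
have cN : N b @[b --> (0 : R)] --> N 0.
  by apply: differentiable_continuous; apply/derivable1_diffP.
have cZ : Z b @[b --> (0 : R)] --> Z 0.
  by apply: differentiable_continuous; apply/derivable1_diffP.
have Z0E : Z 0 = phase_integral (fun _ : spins R => 1).
  by apply: eq_phase_integral => s _; rewrite mul1r mul0r addr0 expR0.
have Z0 : Z 0 != 0.
  rewrite gt_eqF// Z0E; apply: phase_integral_gt0; first exact: bmc.
  by exists 1.
have N0 : N 0 = 3 * Z 0.
  rewrite Z0E -phase_integral_total_spin_sq.
  by apply: eq_phase_integral => s _; rewrite mul0r addr0 expR0 mulr1.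
have cF : 3^-1 * (N b / Z b) @[b --> (0 : R)] --> (1 : R).
  have cNZ : 3^-1 * (N b / Z b) @[b --> (0 : R)] --> 3^-1 * (N 0 / Z 0).
    by apply: cvgM; [exact: cvg_cst|apply: cvgM => //; exact: cvgV].
  by move: cNZ; rewrite N0 mulfK// mulVf.
have cT : T^-1 @[T --> +oo] --> (0 : R).
  apply: (gtr0_cvgV0 (f := id) _).2; last exact: cvg_id.
  exact: nbhs_pinfty_gt.
apply: cvg_trans; last exact: (cvg_comp _ _ cT cF).
apply: near_eq_cvg; near=> T => /=.
have T0 : T != 0 by rewrite gt_eqF//; near: T; exact: nbhs_pinfty_gt.
rewrite temperature_susceptibility//; congr (_ * (_ / _)).
  by apply: eq_phase_integral => s _; rewrite add0r mulrN mulNr.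
by apply: eq_phase_integral => s _; rewrite add0r mulrN mulNr mul1r.
Unshelve. all: by end_near. Qed.

(** Each of the three coordinate products moves by at most [2 * e], since coordinates of points of
    the sphere are bounded by 1. *)
Lemma dot3_box3 (e : R) (s t s' t' : vec3 R) : sphere2 R t -> sphere2 R s' ->
  box3 e s' s -> box3 e t' t ->
  `|dot3 s t - dot3 s' t'| <= 6 * e.
Proof.
move=> tS sS [a1 a2 a3] [b1 b2 b3].
have sq1 (x y z : R) : x * x + y * y + z * z = 1 ->
    [/\ `|x| <= 1, `|y| <= 1 & `|z| <= 1].
  by move=> xyz; rewrite !ler_norml; split; nra.
have [t1 t2 t3] := sq1 _ _ _ tS; have [s1 s2 s3] := sq1 _ _ _ sS.
have step (x y x' y' : R) : `|y| <= 1 -> `|x'| <= 1 -> `|x - x'| < e ->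
    `|y - y'| < e -> `|x * y - x' * y'| <= 2 * e.
  move=> y1 x1 xe ye.
  have -> : x * y - x' * y' = (x - x') * y + x' * (y - y') by ring.
  rewrite (le_trans (ler_normD _ _))// !normrM mulr2n mulrDl mul1r lerD//.
    by rewrite -[leRHS]mulr1 ler_pM// ltW.
  by rewrite -[leRHS]mul1r ler_pM// ltW.
have k1 := step _ _ _ _ t1 s1 a1 b1.
have k2 := step _ _ _ _ t2 s2 a2 b2.
have k3 := step _ _ _ _ t3 s3 a3 b3.
move: k1 k2 k3; rewrite /dot3 !ler_norml.
by move=> /andP[? ?] /andP[? ?] /andP[? ?]; apply/andP; split; lra.
Qed.

(** The angles name one ground state interior to the chart. Boxes around it have positive volume and
    nearly minimal energy, which is what Laplace's method asks for at [b = T^-1]. *)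
Lemma low_temperature_susceptibility (J1 J2 J3 h0 g0 : R) (u1 u2 u3 : vec2 R) :
  (forall u, List.In u [:: u1; u2; u3] -> 0 < u.1 < pi /\ 0 < u.2 < pi *+ 2) ->
  hamiltonian J1 J2 J3 (sphere_param u1, sphere_param u2, sphere_param u3) = h0 ->
  (forall s, phase_space R s -> h0 <= hamiltonian J1 J2 J3 s) ->
  (forall e : R, 0 < e -> exists C : R, forall s, phase_space R s ->
     `|total_spin_sq s - g0| <= e + C * (hamiltonian J1 J2 J3 s - h0)) ->
  T * susceptibility J1 J2 J3 T @[T --> (0 : R)^'+] --> g0 / 3.
Proof.
move=> u123 h0E h0H close.
have small (d : R) : 0 < d -> exists A : set (spins R), [/\ measurable A,
     A `<=` phase_space R, (0 < phase_volume R A)%E &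
     forall s, A s -> hamiltonian J1 J2 J3 s <= h0 + d].
  move=> d0; pose J := `|J1| + `|J2| + `|J3| + 1.
  have J0 : 0 < J by rewrite ltr_wpDl ?addr_ge0.
  (* In a box of size [e] each dot product moves by at most [6 * e], so the energy rises by at most
     [J * (6 * e) = d]. The [+ 1] in [J] covers the case of zero couplings. *)
  pose e := d / (6 * J).
  have e0 : 0 < e by rewrite divr_gt0// mulr_gt0.
  eexists; split; last 2 first.
  - exact: (phase_volume_box3_gt0 e0 u123).
  - move=> [[s1 s2] s3] /= [[[S1 B1] [S2 B2]] [S3 B3]].
    have SP u : sphere2 R (sphere_param u) by exact: dot3_sphere_param.
    have k1 := dot3_box3 S3 (SP u2) B2 B3.
    have k2 := dot3_box3 S1 (SP u3) B3 B1.
    have k3 := dot3_box3 S2 (SP u1) B1 B2.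
    have kJ (j x y : R) : `|x - y| <= 6 * e -> j * x <= j * y + `|j| * (6 * e).
      move=> xy; rewrite -lerBlDl -mulrBr (le_trans (ler_norm _))// normrM.
      exact: ler_wpM2l.
    have dE : d = J * (6 * e) by rewrite /e; field; rewrite gt_eqF.
    move: (kJ J1 _ _ k1) (kJ J2 _ _ k2) (kJ J3 _ _ k3).
    rewrite -h0E dE /J /hamiltonian /=; lra.
  - by apply: measurableX; [apply: measurableX|]; exact: measurable_sphere_box3.
  - by move=> [[s1 s2] s3] /= [[[? _] [? _]] [? _]].
have L := laplace_phase_integral bounded_measurable_total_spin_sq
  (bounded_measurable_hamiltonian J1 J2 J3) h0H small close.
have cT : T^-1 @[T --> (0 : R)^'+] --> +oo.
  apply: (cvgrVy (f := id) _).2; first exact: nbhs_right_gt.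
  by apply: cvg_at_right_filter; exact: cvg_id.
rewrite [g0 / 3]mulrC.
apply: cvg_trans; last exact: (cvgM (cvg_cst (3^-1 : R)) (cvg_comp _ _ cT L)).
apply: near_eq_cvg; near=> T => /=.
by rewrite temperature_susceptibility// gt_eqF.
Unshelve. all: by end_near. Qed.

End temperature_limits.

(** * Ground states *)

Section ground_states.
Context {R : realType}.

(** For unit spins this is the squared length of [x s1 + y s2 + z s3]. Written through the pairwise
    dot products, each instance of its nonnegativity is a linear inequality in those three
    numbers. *)
Definition gram (s : spins R) (x y z : R) : R :=
  x ^+ 2 + y ^+ 2 + z ^+ 2 + 2 * (x * y) * dot3 s.1.1 s.1.2
  + 2 * (x * z) * dot3 s.2 s.1.1 + 2 * (y * z) * dot3 s.1.2 s.2.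

Lemma gram_ge0 (s : spins R) (x y z : R) : phase_space R s -> 0 <= gram s x y z.
Proof.
move=> /phase_space_dot3[e1 e2 e3].
pose v := comb3 1 (comb3 x s.1.1 y s.1.2) z s.2.
have -> : gram s x y z = dot3 v v.
  transitivity (x ^+ 2 * dot3 s.1.1 s.1.1 + y ^+ 2 * dot3 s.1.2 s.1.2
    + z ^+ 2 * dot3 s.2 s.2 + 2 * (x * y) * dot3 s.1.1 s.1.2
    + 2 * (x * z) * dot3 s.2 s.1.1 + 2 * (y * z) * dot3 s.1.2 s.2).
    by rewrite /gram e1 e2 e3 !mulr1.
  by rewrite /v /comb3 /dot3/=; ring.
by rewrite /dot3 -!expr2 !addr_ge0 ?sqr_ge0.
Qed.

(** The condition [y != 0] keeps [x] strictly between -1 and 1, so that the azimuth, [acos x] or its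
    reflection, is interior to the chart. *)
Lemma sphere_param_equator (x y : R) : x ^+ 2 + y ^+ 2 = 1 -> y != 0 ->
  exists u : vec2 R, (0 < u.1 < pi /\ 0 < u.2 < pi *+ 2) /\
    sphere_param u = (x, y, 0).
Proof.
move=> xy y0; have pi0 : 0 < pi :> R := pi_gt0 R.
have h1 : 0 < (pi : R) / 2 by rewrite divr_gt0.
have h2 : (pi : R) / 2 < pi by rewrite ltr_pdivrMr// mulr_natr mulr2n ltrDl.
have y2 : 0 < y ^+ 2 by rewrite exprn_even_gt0.
have x11 : -1 < x < 1 by apply/andP; split; nra.
have x11' : -1 <= x <= 1 by case/andP: x11 => ? ?; rewrite !ltW.
have a0 : 0 < acos x by apply: acos_gt0; case/andP: x11 => /ltW -> ->.
have api : acos x < pi by apply: acos_ltpi; case/andP: x11 => -> /ltW ->.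
have sa : sin (acos x) = `|y|.
  by rewrite sin_acos// -sqrtr_sqr; congr Num.sqrt; lra.
have ca : cos (acos x) = x by apply: acosK; rewrite in_itv.
have par f : cos f = x -> sin f = y ->
    sphere_param ((pi / 2, f) : vec2 R) = (x, y, 0).
  by move=> cf sf; rewrite /sphere_param/= sin_pihalf cos_pihalf cf sf !mul1r.
have [yp|yn] := ltP 0 y.
  exists (pi / 2, acos x); split; last by apply: par; rewrite ?sa ?gtr0_norm.
  split; apply/andP; split => //=.
  by rewrite (lt_trans api)// mulr2n ltrDl.
exists (pi / 2, pi *+ 2 - acos x); split; last first.
  have sN : sin (pi *+ 2 - acos x) = - sin (acos x).
    by rewrite sinB sin2pi cos2pi mul0r mul1r sub0r.
  have cN : cos (pi *+ 2 - acos x) = cos (acos x).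
    by rewrite cosB sin2pi cos2pi mul0r mul1r addr0.
  by apply: par; rewrite ?sN ?cN// sa ler0_norm// opprK.
split; apply/andP; split => //=.
  by rewrite subr_gt0 (lt_trans api)// mulr2n ltrDl.
by rewrite ltrBlDr ltrDl.
Qed.

Let r : R := Num.sqrt 2.

Let r2 : r * r = 2. Proof. by rewrite -expr2 sqr_sqrtr. Qed.

Let r_gt0 : 0 < r. Proof. by rewrite sqrtr_gt0. Qed.

Let r_bounds : 7 / 5 < r /\ r < 10 / 7.
Proof. by have := r2; have := r_gt0; split; nra. Qed.

(** The excess energy is a combination with positive coefficients of the squared lengths of
    [s1 + s2], [s1 + s3] and [s2 - s3]. All three vanish exactly when [s2 = s3 = - s1], where the
    total spin has length 1. *)
Lemma collinear_susceptibility :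
  T * susceptibility (- (1 / 2)) (1 / 2 + r / 2) (r / 2) T
    @[T --> (0 : R)^'+] --> (1 / 3 : R).
Proof.
have [u [uP uE]] : exists u : vec2 R, (0 < u.1 < pi /\ 0 < u.2 < pi *+ 2) /\
    sphere_param u = (0, 1, 0).
  by apply: sphere_param_equator; [ring|exact: oner_neq0].
have [v [vP vE]] : exists u : vec2 R, (0 < u.1 < pi /\ 0 < u.2 < pi *+ 2) /\
    sphere_param u = (0, -1, 0).
  by apply: sphere_param_equator; [ring|rewrite oppr_eq0 oner_neq0].
have [rl ru] := r_bounds.
apply: (@low_temperature_susceptibility _ _ _ _
  (- (1 / 2) - (1 / 2 + r / 2) - r / 2) _ u v v).
- by move=> w /= [<-|[<-|[<-|//]]].
- by rewrite uE vE /hamiltonian /dot3/=; ring.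
- move=> s Ps; have := gram_ge0 1 1 0 Ps; have := gram_ge0 1 0 1 Ps.
  have := gram_ge0 0 1 (-1) Ps; rewrite /gram /hamiltonian.
  set p := dot3 _ _; set q := dot3 _ _; set t := dot3 _ _.
  move=> h1 h2 h3; nra.
(* With [p], [q], [t] the dot products of [s1 s2], [s3 s1], [s2 s3], the deviation is a signed sum
   of [1 + p], [1 + q] and [1 - t] with coefficients 2 or -2. In the excess energy these terms have
   coefficients at least [1 / 2]. *)
- move=> e e0; exists 4 => s Ps.
  have := gram_ge0 1 1 0 Ps; have := gram_ge0 1 0 1 Ps.
  have := gram_ge0 0 1 (-1) Ps; rewrite (total_spin_sqE Ps) /gram /hamiltonian.
  set p := dot3 _ _; set q := dot3 _ _; set t := dot3 _ _.
  move=> h1 h2 h3; rewrite ler_norml; apply/andP; split; nra.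
Qed.

(* The ground states of (iii) satisfy [D = 0] for
   [D = 2 s1 - 2 (r - 1) s2 - r s3], whose coefficients are proportional to
   [1 / J_i]: the Hamiltonian is [(r + 2) / 16 * |D|^2 - (r + 10) / 8].
   [proj_i] is the inner product of [D] and [s_i]. *)
Let proj1 (s : spins R) : R :=
  2 - 2 * (r - 1) * dot3 s.1.1 s.1.2 - r * dot3 s.2 s.1.1.

Let proj2 (s : spins R) : R :=
  2 * dot3 s.1.1 s.1.2 - 2 * (r - 1) - r * dot3 s.1.2 s.2.

Let proj3 (s : spins R) : R :=
  2 * dot3 s.2 s.1.1 - 2 * (r - 1) * dot3 s.1.2 s.2 - r.

Let HE (s : spins R) :
  (r + 2) / 16 * gram s 2 (- 2 * (r - 1)) (- r) =
  hamiltonian (1 / 2) (- (1 / 2) - r / 2) (- (r / 2)) s - - ((r + 10) / 8).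
Proof.
rewrite /gram /hamiltonian.
set p := dot3 s.1.1 s.1.2; set q := dot3 s.2 s.1.1; set t := dot3 s.1.2 s.2.
apply/eqP; rewrite -subr_eq0; apply/eqP.
(* The identity holds only modulo [r * r = 2]; the difference of the sides is displayed as a
   multiple of [r * r - 2]. *)
transitivity ((r * r - 2) * ((5 * r + 2) / 16 - p / 2 - q / 4 + (r + 1) * t / 4)).
  by field.
by rewrite r2 subrr mul0r.
Qed.

(** On the ground states the three projections of [D] vanish, which are linear equations fixing all
    pairwise dot products and hence the squared total spin. Off them the deviation is a combination
    of these projections and the squared length of [D]. *)
Let spin_sqE (s : spins R) : phase_space R s ->
  total_spin_sq s - (11 / 2 + 3 / 2 * r) =
  (1 - r) / 4 * gram s 2 (- 2 * (r - 1)) (- r)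
  + - (2 + r) * proj1 s + (r - 2) * proj2 s + - ((2 + r) / 2) * proj3 s.
Proof.
move=> Ps; rewrite total_spin_sqE// /gram /proj1 /proj2 /proj3.
set p := dot3 s.1.1 s.1.2; set q := dot3 s.2 s.1.1; set t := dot3 s.1.2 s.2.
apply/eqP; rewrite -subr_eq0; apply/eqP.
transitivity (- (r * r - 2) * (- 5 / 4 * r + 7 / 4 + 4 * p + 2 * q + (2 - r) * t)).
  by field.
by rewrite r2 subrr oppr0 mul0r.
Qed.

Lemma coplanar_susceptibility :
  T * susceptibility (1 / 2) (- (1 / 2) - r / 2) (- (r / 2)) T
    @[T --> (0 : R)^'+] --> (11 / 6 + 1 / r : R).
Proof.
have [rl ru] := r_bounds.
have -> : 11 / 6 + 1 / r = (11 / 2 + 3 / 2 * r) / 3.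
  have -> : 1 / r = r / 2.
    have r0 : r != 0 by rewrite gt_eqF.
    by apply/eqP; rewrite (eqr_div _ _ r0)// mul1r r2.
  by field.
(* Put [s1 = (0, 1, 0)]. The second coordinates of [s2] and [s3] below are the dot products with
   [s1] forced by [D = 0], [w] makes [s2] a unit vector, and the first coordinate of [s3] comes from
   [D = 0] with [2 * (r - 1) / r = 2 - r]. *)
pose w := Num.sqrt ((6 * r - 3) / 16).
have w2 : w * w = (6 * r - 3) / 16.
  by rewrite -expr2 sqr_sqrtr// divr_ge0//; lra.
have [u1 [u1P u1E]] : exists u : vec2 R, (0 < u.1 < pi /\ 0 < u.2 < pi *+ 2) /\
    sphere_param u = (0, 1, 0).
  by apply: sphere_param_equator; [ring|exact: oner_neq0].
have [u2 [u2P u2E]] : exists u : vec2 R, (0 < u.1 < pi /\ 0 < u.2 < pi *+ 2) /\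
    sphere_param u = (- w, (3 * r - 1) / 4, 0).
  apply: sphere_param_equator.
    transitivity (w * w + (9 * (r * r) - 6 * r + 1) / 16); first by field.
    by rewrite w2 r2; field.
  by rewrite gt_eqF//; lra.
have [u3 [u3P u3E]] : exists u : vec2 R, (0 < u.1 < pi /\ 0 < u.2 < pi *+ 2) /\
    sphere_param u = ((2 - r) * w, (8 - 3 * r) / 4, 0).
  apply: sphere_param_equator; last by rewrite gt_eqF//; lra.
  transitivity ((4 - 4 * r + r * r) * (w * w)
    + (64 - 48 * r + 9 * (r * r)) / 16); first by field.
  rewrite w2 r2.
  transitivity ((64 - 24 * (r * r)) / 16); last by rewrite r2; field.
  by field.
apply: (@low_temperature_susceptibility _ _ _ _ (- ((r + 10) / 8)) _ u1 u2 u3).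
- by move=> u /= [<-|[<-|[<-|//]]].
- rewrite u1E u2E u3E /hamiltonian /dot3/=.
  transitivity (- (2 - r) * (w * w) / 2 + (3 * r - 1) * (8 - 3 * r) / 32
    - (1 / 2 + r / 2) * ((8 - 3 * r) / 4) - r / 2 * ((3 * r - 1) / 4)); first by field.
  by rewrite w2; have := r2; lra.
- move=> s Ps; rewrite -subr_ge0 -HE// mulr_ge0 ?gram_ge0//.
  by rewrite divr_ge0//; lra.
(* The deviation will be at most [e + (1 + 36 / e) * G]. The excess energy is [(r + 2) / 16 * G],
   and 8 times it dominates [G]. *)
- move=> e e0; exists (8 * (1 + 36 / e)) => s Ps.
  rewrite -HE// spin_sqE//.
  set G := gram s 2 (- 2 * (r - 1)) (- r).
  have G0 : 0 <= G by exact: gram_ge0.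
  pose a : R := e / 6; have a0 : 0 < a by rewrite divr_gt0.
  (* Nonnegativity of the squared length of [D] plus or minus [a] times a spin bounds each
     projection by [M], linearly in [G]. The choice [a = e / 6] makes [12 * M], from three terms
     with coefficients at most 4, equal to [e + 36 / e * G]. *)
  pose M := (G / a + a) / 2.
  have dM d : 0 <= G - 2 * a * d + a ^+ 2 -> 0 <= G + 2 * a * d + a ^+ 2 ->
      `|d| <= M.
    have aM : 2 * a * M = G + a ^+ 2 by rewrite /M; field; rewrite gt_eqF.
    move=> ? ?; rewrite -(ler_pM2l (_ : 0 < 2 * a)) ?mulr_gt0// aM.
    by rewrite -[2 * a]gtr0_norm ?mulr_gt0// -normrM ler_norml; apply/andP; split; lra.
  have bM c d : `|c| <= 4 -> `|d| <= M -> `|c * d| <= 4 * M.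
    by move=> c4 dm; rewrite normrM ler_pM.
  have b1 : `|- (2 + r) * proj1 s| <= 4 * M.
    apply: bM; first by rewrite ler_norml; apply/andP; split; lra.
    apply: dM.
      have := gram_ge0 (2 - a) (- 2 * (r - 1)) (- r) Ps.
      by rewrite /G /gram /proj1; lra.
    have := gram_ge0 (2 + a) (- 2 * (r - 1)) (- r) Ps.
    by rewrite /G /gram /proj1; lra.
  have b2 : `|(r - 2) * proj2 s| <= 4 * M.
    apply: bM; first by rewrite ler_norml; apply/andP; split; lra.
    apply: dM.
      have := gram_ge0 2 (- 2 * (r - 1) - a) (- r) Ps.
      by rewrite /G /gram /proj2; lra.
    have := gram_ge0 2 (- 2 * (r - 1) + a) (- r) Ps.
    by rewrite /G /gram /proj2; lra.
  have b3 : `|- ((2 + r) / 2) * proj3 s| <= 4 * M.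
    apply: bM; first by rewrite ler_norml; apply/andP; split; lra.
    apply: dM.
      have := gram_ge0 2 (- 2 * (r - 1)) (- r - a) Ps.
      by rewrite /G /gram /proj3; lra.
    have := gram_ge0 2 (- 2 * (r - 1)) (- r + a) Ps.
    by rewrite /G /gram /proj3; lra.
  have b0 : `|(1 - r) / 4 * G| <= G.
    rewrite normrM (ger0_norm G0) -[leRHS]mul1r ler_wpM2r//.
    by rewrite ler_norml; apply/andP; split; lra.
  rewrite (le_trans (ler_normD _ _))// (le_trans (lerD (ler_normD _ _) b3))//.
  rewrite (le_trans (lerD (lerD (ler_normD _ _) (lexx _)) (lexx _)))//.
  rewrite (le_trans (lerD (lerD (lerD b0 b1) b2) (lexx _)))//.
  have -> : G + 4 * M + 4 * M + 4 * M = e + (1 + 36 / e) * G.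
    by rewrite /M /a; field; rewrite gt_eqF.
  set k := 1 + 36 / e.
  have k0 : 0 <= k by rewrite addr_ge0// divr_ge0// ltW.
  have kGr : 0 <= k * G * r by rewrite !mulr_ge0// ltW.
  by rewrite lerD2l; lra.
Qed.

End ground_states.

Unset Implicit Arguments.

Theorem mainTheorem4 (R : realType) :
  [/\ forall J1 J2 J3 : R,
        T * susceptibility J1 J2 J3 T @[T --> +oo] --> (1 : R),
      T * susceptibility (- (1 / 2)) (1 / 2 + Num.sqrt 2 / 2) (Num.sqrt 2 / 2) T
        @[T --> (0 : R)^'+] --> (1 / 3 : R)
    & T * susceptibility (1 / 2) (- (1 / 2) - Num.sqrt 2 / 2)
          (- (Num.sqrt 2 / 2)) T
        @[T --> (0 : R)^'+] --> (11 / 6 + 1 / Num.sqrt 2 : R)].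
Proof.
split.
- exact: high_temperature_susceptibility.
- exact: collinear_susceptibility.
- exact: coplanar_susceptibility.
Qed.
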